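(* In the AI-augmented cascade model with $q,\alpha\in(\tfrac12,1)$, let $\ell_{\mathrm{ext}}^{\mathrm{naive}}$ and $\ell_{\mathrm{ext}}^{\mathrm{correct}}$ be the naive and Bayes-correct external observers' log-odds after $N$ judgments. Then the Bayes-correct observer's posterior log-odds are bounded in expectation uniformly in $N$: $$\mathbb E\bigl[\,|\ell_{\mathrm{ext}}^{\mathrm{correct}}|\,\bigr]\le|\ell_0|+L_\alpha+\mathbb E[\tau-1]\,L_q ,$$ and the naive observer's excess log-odds in the final consensus direction grow linearly: $$\mathbb E\bigl[(\ell_{\mathrm{ext}}^{\mathrm{naive}}-\ell_{\mathrm{ext}}^{\mathrm{correct}})\,D_\infty\bigr]=N L_q+O(1),$$ where the $O(1)$ term is uniformly bounded in $N$. Taking $\ell_0=0$, the constant is pinned down by the comparison of $\alpha$ with $q$: (a) if $\alpha\ge q$ (so $\tau=1$ and $J_i=c$ for all $i$), then $$\mathbb E\bigl[(\ell_{\mathrm{ext}}^{\mathrm{naive}}-\ell_{\mathrm{ext}}^{\mathrm{correct}})\,D_\infty\bigr]=N L_q-L_\alpha ;$$ the only independent evidence the Bayes-correct observer can credit is the shared AI prediction $c$, and no private impression is revealed; (b) if $\tfrac12<\alpha<q$ (so $\tau\ge2$), then the $O(1)$ term equals the bounded evidence in $c$ together with the finite pre-cascade prefix $\sigma_{<\tau}$, and is uniformly bounded in $N$ by $L_\alpha+\mathbb E[\tau-1]\,L_q$.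
   Context: AI-augmented cascade model. A binary state $\theta\in\{0,1\}$ has prior $\pi_0=\Pr(\theta=1)\in(0,1)$, $\ell_0=\log\frac{\pi_0}{1-\pi_0}$. Users $i=1,2,\dots$ act sequentially. User $i$ has a private signal (private impression) $s_i\in\{0,1\}$ with $\Pr(s_i=\theta\mid\theta)=q$; there is one common AI signal (AI prediction) $c\in\{0,1\}$ with $\Pr(c=\theta\mid\theta)=\alpha$, seen by every user; given $\theta$, the variables $c,s_1,s_2,\dots$ are mutually independent. User $i$ observes $s_i$, $c$ and the public history $(J_1,\dots,J_{i-1})$. Write $L_\rho=\log\frac{\rho}{1-\rho}$ and $\lambda(x;\rho)=(2x-1)L_\rho$ for $x\in\{0,1\}$. The public log-odds are $P_i=\ell_0+\lambda(c;\alpha)+\sum_{j<i}\psi_j(J_j)$, where $\psi_j(J_j)=\log\frac{\Pr(J_j\mid\theta=1,P_j)}{\Pr(J_j\mid\theta=0,P_j)}$ (probabilities conditional on the public log-odds $P_j$ under which user $j$ acted). User $i$'s posterior log-odds are $\ell_i=P_i+\lambda(s_i;q)$, and her judgment is $J_i=1$ if $\ell_i>0$, $J_i=0$ if $\ell_i<0$, and $J_i=\mathbf 1\{P_i\ge0\}$ if $\ell_i=0$. The cascade-formation time is $\tau=\inf\{i\ge1:|P_i|\ge L_q\}$, and the final cascade (consensus) direction is $D_\infty=\lim_{i\to\infty}\operatorname{sign}(P_i)\in\{-1,+1\}$, with $D_\infty=+1$ (resp. $-1$) if $(P_i)$ is absorbed in $\{P\ge L_q\}$ (resp. $\{P\le-L_q\}$).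 The pre-cascade prefix is $\sigma_{<\tau}=(s_1,\dots,s_{\tau-1})$, the private impressions of the users acting before the cascade forms; these are exactly the impressions revealed by the judgments, since a user with $|P_i|<L_q$ has $J_i=s_i$, whereas judgments at positions $i\ge\tau$ do not depend on $s_i$. External observers see only the judgment sequence $(J_1,\dots,J_N)$. The naive observer treats each judgment as an independent private signal of accuracy $q$: $\ell_{\mathrm{ext}}^{\mathrm{naive}}=\ell_0+\sum_{i=1}^N(2J_i-1)L_q$. The Bayes-correct observer, conditional on the realized judgment sequence, marginalizes over $(c,\sigma_{<\tau})$ using the model's likelihood: $\ell_{\mathrm{ext}}^{\mathrm{correct}}=\log\frac{\Pr(\theta=1\mid J_1,\dots,J_N)}{\Pr(\theta=0\mid J_1,\dots,J_N)}$. Expectations are over the joint law of all variables in the model. *)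

(* Defs.v *)
From HB Require Import structures.
From mathcomp Require Export all_boot all_order all_algebra.
From mathcomp Require Export all_classical all_reals all_analysis.
Export Order.TTheory GRing.Theory Num.Theory.
Export numFieldNormedType.Exports.

Set Implicit Arguments.
Unset Strict Implicit.
Unset Printing Implicit Defensive.

Local Open Scope classical_set_scope.
Local Open Scope ring_scope.

Definition logit (R : realType) (rho : R) : R := ln (rho / (1 - rho)).

(* lambda(x; rho): the log-likelihood ratio carried by a binary signal x of
   accuracy rho. *)
Definition llr (R : realType) (x : bool) (rho : R) : R :=
  (2 * x%:R - 1) * logit rho.

Definition cond_prob (R : realType) (d : measure_display)
    (T : measurableType d) (P : probability T R) (A B : set T) : R :=
  fine (P (A `&` B)) / fine (P B).

(* Product rule for every finite subfamily, conditionally on B. *)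
Definition cond_mutually_independent (R : realType) (d : measure_display)
    (T : measurableType d) (P : probability T R) (K : eqType)
    (X : K -> T -> bool) (B : set T) : Prop :=
  forall (I : seq K) (v : K -> bool), uniq I ->
    cond_prob P [set w | forall k, k \in I -> X k w = v k] B =
    \prod_(k <- I) cond_prob P [set w | X k w = v k] B.

(* Users 1, 2, 3, ... have indices 0, 1, 2, ...: `signal i`, `public i` and
   `judgment i` below stand for s_{i+1}, P_{i+1} and J_{i+1}.  The family of signals is indexed by `option nat`, with `None` for
   the AI signal. *)
Record cascade_model (R : realType) (d : measure_display)
    (Omega : measurableType d) := CascadeModel {
  law : probability Omega R;
  pi0 : R;
  q : R;
  alpha : R;
  state : {RV law >-> bool};
  AI : {RV law >-> bool};
  signal : nat -> {RV law >-> bool};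
  pi0_itv : 0 < pi0 < 1;
  stateE : law [set w | state w = true] = pi0%:E;
  AI_accuracy : forall t : bool,
    cond_prob law [set w | AI w = t] [set w | state w = t] = alpha;
  signal_accuracy : forall (i : nat) (t : bool),
    cond_prob law [set w | signal i w = t] [set w | state w = t] = q;
  signals_indep : forall t : bool,
    cond_mutually_independent law
      (fun (k : option nat) w => if k is Some i then signal i w else AI w)
      [set w | state w = t] }.

Section Cascade.
Context (R : realType) (d : measure_display) (Omega : measurableType d).
Variable M : cascade_model R Omega.
Implicit Types (i N : nat) (w : Omega).

Definition prior_logodds : R := logit (pi0 M).

Definition decide (p : R) (x : bool) : bool :=
  let l := p + llr x (q M) in
  if 0 < l then true else if l < 0 then false else 0 <= p.

(* psi: log-likelihood ratio of a realized judgment, conditionally on the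
   realized value of the public log-odds under which it was made. *)
Definition judgment_llr (p : Omega -> R) (J : Omega -> bool) w : R :=
  ln (cond_prob (law M) [set w' | J w' = J w]
        [set w' | state M w' = true /\ p w' = p w] /
      cond_prob (law M) [set w' | J w' = J w]
        [set w' | state M w' = false /\ p w' = p w]).

Fixpoint public i : Omega -> R :=
  if i is j.+1 then fun w =>
    public j w +
    judgment_llr (public j) (fun w' => decide (public j w') (signal M j w')) w
  else fun w => prior_logodds + llr (AI M w) (alpha M).

Definition judgment i w : bool := decide (public i w) (signal M i w).

(* The least user number (counted from 1, hence i.+1) at which the public
   log-odds reach L_q in absolute value; +oo without a cascade. *)
Definition tau w : \bar R :=
  ereal_inf [set (i.+1)%:R%:E | i in [set i : nat | logit (q M) <= `|public i w|]].

Definition expected_delay : \bar R := (\int[law M]_w (tau w - 1))%E.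

(* Junk value where the limit does not exist, a null event. *)
Definition direction w : R := limn (fun i => Num.sg (public i w)).

(* sigma_{<tau}, restricted to the first N users. *)
Definition prefix_signals N w : seq bool :=
  [seq signal M i w | i <- iota 0 N & ((i.+1)%:R%:E < tau w)%E].

Definition naive_logodds N w : R :=
  prior_logodds + \sum_(i < N) (2 * (judgment i w)%:R - 1) * logit (q M).

Definition same_judgments N w : set Omega :=
  [set w' | forall i, (i < N)%N -> judgment i w' = judgment i w].

Definition correct_logodds N w : R :=
  ln (cond_prob (law M) [set w' | state M w' = true] (same_judgments N w) /
      cond_prob (law M) [set w' | state M w' = false] (same_judgments N w)).

Definition expected_excess N : \bar R :=
  'E_(law M)[(fun w =>
    (naive_logodds N w - correct_logodds N w) * direction w)%R]%E.

Definition accuracy_weight (rho : R) (b : bool) : R := if b then rho else 1 - rho.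

Definition produces N w (x : bool) (v : seq bool) : Prop :=
  exists w', [/\ AI M w' = x, prefix_signals N w' = v & same_judgments N w w'].

(* Likelihood, under the state t, of the N judgments realized at w, obtained by
   summing over the values (x, v) of the AI signal and of the pre-cascade prefix
   that produce these judgments the model likelihood of (x, v). *)
Definition marginal_likelihood N w (t : bool) : R :=
  \sum_(x : bool) \sum_(n < N.+1) \sum_(v : n.-tuple bool | `[< produces N w x v >])
    accuracy_weight (alpha M) (x == t) *
    \prod_(b <- v) accuracy_weight (q M) (b == t).

Definition marginal_evidence N w : R :=
  ln (marginal_likelihood N w true / marginal_likelihood N w false).

(* Contribution of the pre-cascade prefix to the naive log-odds in the final
   direction, in excess of one unit L_q per prefix user. *)
Definition prefix_excess N w : R :=
  \sum_(b <- prefix_signals N w) (llr b (q M) * direction w - logit (q M)).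

(* What remains of the expected excess, when the prior log-odds are 0, after
   N * L_q: the prefix correction of the naive log-odds minus the evidence in
   the AI signal and the prefix credited by the Bayes-correct observer. *)
Definition evidence_term N : \bar R :=
  'E_(law M)[(fun w =>
    prefix_excess N w - marginal_evidence N w * direction w)%R]%E.

End Cascade.

(* Main.v *)
Require Import Defs.
From mathcomp Require Import measurable_realfun ring lra.

Set Implicit Arguments.
Unset Strict Implicit.
Unset Printing Implicit Defensive.

Local Open Scope classical_set_scope.
Local Open Scope ring_scope.

(** Up to the cascade each judgment reveals the signal, so the public log-odds
    move by [L_q] towards the signal; afterwards they are frozen.  A signal that
    moves them away from 0 triggers the cascade, so the walk survives [n] steps
    with probability at most [q ^ n], and the delay [tau - 1] has finite mean.

    The AI signal and the prefix determine the judgments, and an observer of both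
    has posterior log-odds [public N].  As [`|logit|] is convex, Jensen's
    inequality bounds the mean of [`|correct_logodds N|] by the mean of
    [`|public N|], which is at most [`|l_0| + L_alpha + (tau - 1) L_q].

    After the cascade every judgment contributes exactly [L_q] to the naive
    log-odds in the final direction [D]; this leaves a remainder made of the
    correct log-odds and of the [L_q (1 - D s_i)] of the prefix users (signals
    [s_i] in {-1, 1}).  For the sharp bound of case (b), sum these terms pointwise
    with [`|public N|]: the total is at most [L_alpha + (tau - 1) L_q], because
    the public log-odds can point against [D] only if two more users still have
    to act before the cascade. *)

(** * Convexity of the absolute log-odds *)

Section LogInequalities.
Context {R : realType}.
Implicit Types (a b r t x : R).

Lemma nondecreasing_pos_derive (f df : R -> R) a b :
  (forall x, 0 < x -> is_derive x (1 : R) f (df x)) ->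
  (forall x, 0 < x -> 0 <= df x) ->
  0 < a -> a <= b -> f a <= f b.
Proof.
move=> fdf df0 a0 ab.
have drv x : 0 < x -> derivable f x 1 by move=> /fdf [].
apply: (@ger0_derive1_ndecr _ f a b) => // [x|x|].
- by rewrite in_itv /= => /andP[ax _]; apply: drv; apply: lt_trans ax.
- rewrite in_itv /= => /andP[ax _].
  have x0 : 0 < x by apply: lt_trans ax.
  have ? := fdf _ x0.
  by rewrite derive1E derive_val; exact: df0.
- apply: derivable_within_continuous => x; rewrite in_itv /= => /andP[ax _].
  by apply: drv; apply: lt_le_trans ax.
Qed.

(** The difference vanishes at 1 and has derivative [(1 - y^-1) ^+ 2 / 2], which is nonnegative.
    This bound serves the tangent inequality to the left of the tangency point, the next one to the
    right of it. *)
Lemma ln_le_half_subV x : 1 <= x -> ln x <= (x - x^-1) / 2.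
Proof.
move=> x1.
pose f y : R := (y - y^-1) / 2 - ln y.
suff : f 1 <= f x by rewrite /f invr1 subrr mul0r ln1 subrr subr_ge0.
apply: (@nondecreasing_pos_derive f (fun y => (1 - y^-1) ^+ 2 / 2)) => // y y0.
  have y_neq0 : y != 0 by rewrite gt_eqF.
  have ? := is_derive1_ln y0.
  have ? := @is_deriveV R (id : R -> R) y 1 1 y_neq0 (@is_derive_id _ _ _ _).
  rewrite /f; apply: is_derive_eq; rewrite /GRing.scale /=; field.
  exact: y_neq0.
by rewrite mulr_ge0 // sqr_ge0.
Qed.

Lemma ln_ge_Cayley x : 1 <= x -> 2 * (x - 1) / (x + 1) <= ln x.
Proof.
move=> x1.
pose f y : R := ln y - 2 * (y - 1) / (y + 1).
suff : f 1 <= f x by rewrite /f subrr mulr0 mul0r ln1 subrr subr_ge0.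
apply: (@nondecreasing_pos_derive f
  (fun y => (y - 1) ^+ 2 / (y * (y + 1) ^+ 2))) => // y y0.
  have y_neq0 : y != 0 by rewrite gt_eqF.
  have y1_neq0 : y + 1 != 0 by rewrite gt_eqF // addr_gt0.
  have ? := is_derive1_ln y0.
  have ? := @is_deriveV R (fun z : R => z + 1) y 1 1 y1_neq0 (@is_derive_shift _ _ _ _).
  rewrite /f; apply: is_derive_eq; rewrite /GRing.scale /=; field.
  by rewrite y1_neq0 y_neq0.
by rewrite divr_ge0 ?sqr_ge0 // mulr_ge0 ?sqr_ge0 // ltW.
Qed.

(* The tangent line at [r] of the convex function [(t + 1) * `|ln t|], which is
   the perspective form of [|logit|]. *)
Lemma abs_ln_tangent r t : 1 <= r -> 0 < t ->
  (t + 1) * ln r + (1 + r^-1) * (t - r) <= (t + 1) * `|ln t|.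
Proof.
move=> r1 t0.
have r0 : 0 < r by apply: lt_le_trans r1.
have t10 : 0 < t + 1 by rewrite addr_gt0.
(* To the right of [r], writing [ln t = ln (t / r) + ln r] leaves a claim about [ln (t / r)]
   alone. *)
have [rt|tr] := leP r t.
  rewrite ger0_norm ?ln_ge0 ?(le_trans r1) //.
  have -> : ln t = ln (t / r) + ln r by rewrite ln_div ?posrE // subrK.
  have h : 2 * (t / r - 1) / (t / r + 1) <= ln (t / r).
    by apply: ln_ge_Cayley; rewrite ler_pdivlMr // mul1r.
  have h2 : (1 + r^-1) * (t - r) <= (t + 1) * (2 * (t / r - 1) / (t / r + 1)).
    have -> : (t + 1) * (2 * (t / r - 1) / (t / r + 1)) =
              (2 * (t + 1) * (t - r)) / (t + r).
      by field; rewrite !gt_eqF //= ?addr_gt0.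
    have -> : (1 + r^-1) * (t - r) = (r + 1) * (t - r) / r.
      by field; rewrite gt_eqF.
    rewrite ler_pdivlMr ?addr_gt0 // mulrAC ler_pdivrMr //.
    (* The difference of the two sides is [(r - 1) * (t - r)]. *)
    have h3 : (r + 1) * (t + r) <= 2 * (t + 1) * r by nra.
    have tr0 : 0 <= t - r by rewrite subr_ge0.
    have := ler_wpM2l tr0 h3; nra.
  have h3 := ler_wpM2l (ltW t10) h.
  by rewrite [leRHS]mulrDr [leLHS]addrC lerD2r (le_trans h2).
have [t1|t1] := leP 1 t.
  rewrite ger0_norm ?ln_ge0 //.
  have -> : ln r = ln (r / t) + ln t by rewrite ln_div ?posrE // subrK.
  have h : ln (r / t) <= (r / t - (r / t)^-1) / 2.
    by apply: ln_le_half_subV; rewrite ler_pdivlMr // mul1r ltW.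
  have h2 : (t + 1) * ((r / t - (r / t)^-1) / 2) <= (1 + r^-1) * (r - t).
    have -> : (t + 1) * ((r / t - (r / t)^-1) / 2) =
        (t + 1) * (r - t) * (r + t) / (2 * r * t).
      by field; rewrite !gt_eqF.
    have -> : (1 + r^-1) * (r - t) = (r + 1) * (r - t) / r.
      by field; rewrite gt_eqF.
    rewrite ler_pdivrMr ?mulr_gt0 // [leRHS]mulrAC ler_pdivlMr //.
    (* The difference of the two sides is [(t - 1) * (r - t)]. *)
    have h3 : (t + 1) * (r + t) <= (r + 1) * (2 * t) by nra.
    have rt0 : 0 <= r * (r - t).
      by apply: mulr_ge0; rewrite ?subr_ge0 ltW.
    have := ler_wpM2l rt0 h3; nra.
  have := ler_wpM2l (ltW t10) h; nra.
(* To the left of 1 the tangent line is already nonpositive: it is at most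
   [(r + 1) ^+ 2 * (t - 1) / (2 * r)]. *)
have h : ln r <= (r - r^-1) / 2 by exact: ln_le_half_subV.
have l0 : 0 <= `|ln t| by [].
have lt : 1 - t <= `|ln t|.
  rewrite ler0_norm; last by rewrite ln_le0 ?ltW.
  have : ln (1 + (t - 1)) <= t - 1 by apply: le_ln1Dx; lra.
  by rewrite subrKC; lra.
have h4 : (t + 1) * ((r - r^-1) / 2) + (1 + r^-1) * (t - r) <= 0.
  have -> : (t + 1) * ((r - r^-1) / 2) + (1 + r^-1) * (t - r) =
     (r + 1) * (t - 1) * (r + 1) / (2 * r).
    by field; rewrite gt_eqF.
  rewrite ler_pdivrMr ?mulr_gt0 // mul0r.
  by rewrite -mulrA mulrC -mulrA mulr_le0_ge0 ?mulr_ge0 ?subr_le0 ?ltW ?addr_gt0 //.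
have := ler_wpM2l (ltW t10) h.
have : 0 <= (t + 1) * `|ln t| by rewrite mulr_ge0 // ltW.
lra.
Qed.

(** The function [(a + b) * |ln (a / b)|] is convex and positively homogeneous, hence subadditive.
    When [a] and [b] are the joint probabilities of an observation with the two states, this is
    Jensen's inequality for the absolute posterior log-odds. *)
Lemma abs_ln_div_subadditive (I : Type) (s : seq I) (Q : pred I) (a b : I -> R) :
  (forall i, a i = 0 /\ b i = 0 \/ 0 < a i /\ 0 < b i) ->
  (\sum_(i <- s | Q i) a i + \sum_(i <- s | Q i) b i) *
    `|ln ((\sum_(i <- s | Q i) a i) / (\sum_(i <- s | Q i) b i))| <=
  \sum_(i <- s | Q i) (a i + b i) * `|ln (a i / b i)|.
Proof.
move=> ab.
have swap (x y : R) : 0 <= x -> 0 <= y -> `|ln (x / y)| = `|ln (y / x)|.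
  rewrite le_eqVlt => /predU1P[<-|x0]; first by rewrite invr0 mul0r mulr0.
  rewrite le_eqVlt => /predU1P[<-|y0]; first by rewrite invr0 mul0r mulr0.
  by rewrite !ln_div ?posrE // distrC.
(* Exchanging [a] and [b] changes neither side, so the ratio of the sums may be taken at least 1, as
   the tangent inequality requires. *)
wlog BA : a b ab / \sum_(i <- s | Q i) b i <= \sum_(i <- s | Q i) a i.
  move=> W; have [|/ltW] := leP (\sum_(i <- s | Q i) b i) (\sum_(i <- s | Q i) a i).
    exact: W.
  have a0 i : 0 <= a i by case: (ab i) => -[]; [move=> ->|move=> /ltW].
  have b0 i : 0 <= b i by case: (ab i) => -[_]; [move=> ->|move=> /ltW].
  move=> /W; rewrite addrC swap ?sumr_ge0 // => H.
  apply: le_trans (H _) _; first by move=> i; case: (ab i) => -[]; [left|right].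
  by apply: ler_sum => i _; rewrite addrC swap.
set A := \sum_(i <- s | Q i) a i in BA *; set B := \sum_(i <- s | Q i) b i in BA *.
have b0 i : 0 <= b i by case: (ab i) => -[_]; [move=> ->|move=> /ltW].
have : 0 <= B by rewrite sumr_ge0.
rewrite le_eqVlt => /predU1P[<-|B0].
  rewrite invr0 mulr0 ln0 // normr0 mulr0 sumr_ge0 // => i _.
  by case: (ab i) => -[a0 b0']; rewrite mulr_ge0 // addr_ge0 // ?a0 // ltW.
have r1 : 1 <= A / B by rewrite ler_pdivlMr // mul1r.
have A0 : 0 < A by apply: lt_le_trans BA.
rewrite [X in _ * X]ger0_norm ?ln_ge0 //.
set r := A / B in r1 *.
(* The tangent form, linear in the pairs, is exact at the pair of sums: the terms without [ln r]
   cancel because [r = A / B]. *)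
have -> : (A + B) * ln r = \sum_(i <- s | Q i)
    (a i * (ln r + 1 + r^-1) + b i * (ln r - r - 1)).
  rewrite big_split -!mulr_suml /= -/A -/B /r invf_div; field.
  by rewrite !gt_eqF.
apply: ler_sum => i _; case: (ab i) => -[ai bi].
  by rewrite ai bi !mul0r addr0 mul0r.
have r0 : 0 < r by apply: lt_le_trans r1.
(* The tangent inequality at [a i / b i], scaled by [b i]. *)
have := ler_wpM2l (ltW bi) (abs_ln_tangent r1 (divr_gt0 ai bi)).
set l := `|_|; suff [-> ->] :
  b i * ((a i / b i + 1) * ln r + (1 + r^-1) * (a i / b i - r)) =
  a i * (ln r + 1 + r^-1) + b i * (ln r - r - 1) /\
  b i * ((a i / b i + 1) * l) = (a i + b i) * l by [].
by split; field; rewrite !gt_eqF.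
Qed.

End LogInequalities.

(** * Finite-valued random variables *)

Section RealProbability.
Context {R : realType} {d : measure_display} {T : measurableType d}.
Variable P : probability T R.
Implicit Types (A B : set T).

Definition prob A : R := fine (P A).

Lemma probE A : measurable A -> P A = (prob A)%:E.
Proof. by move=> mA; rewrite fineK ?fin_num_measure. Qed.

Lemma prob_ge0 A : 0 <= prob A.
Proof. exact: fine_ge0. Qed.

Lemma prob0 : prob set0 = 0.
Proof. by rewrite /prob measure0. Qed.

Lemma probT : prob setT = 1.
Proof. by rewrite /prob probability_setT. Qed.

Lemma probU A B : measurable A -> measurable B -> A `&` B = set0 ->
  prob (A `|` B) = prob A + prob B.
Proof.
move=> mA mB AB0; rewrite /prob measureU // fineD ?fin_num_measure //.
Qed.

Lemma prob_le A B : measurable A -> measurable B -> A `<=` B ->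
  prob A <= prob B.
Proof.
by move=> mA mB AB; rewrite fine_le ?fin_num_measure // le_measure // inE.
Qed.

Lemma prob_bool (X : T -> bool) A : (forall b, measurable [set w | X w = b]) ->
  measurable A -> prob A =
  prob (A `&` [set w | X w = true]) + prob (A `&` [set w | X w = false]).
Proof.
move=> mX mA; rewrite -probU; first last.
- by rewrite -subset0 => w [[_ /= ->] []].
- exact: measurableI.
- exact: measurableI.
congr prob; apply/seteqP; split => [w Aw|w [][]//].
by rewrite /setU /setI /=; case: (X w); [left|right].
Qed.

Lemma integrable_prob_indic A : measurable A ->
  P.-integrable setT (EFin \o (\1_A : T -> R)).
Proof. by move=> mA; apply: integrable_indic; rewrite // -ge0_fin_numE ?fin_num_measure. Qed.

Section FiniteValued.
Context {K : finType}.
Variable D : T -> K.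
Hypothesis mD : forall k, measurable [set w | D w = k].

Lemma finite_preimage_measurable (Y : set K) : measurable (D @^-1` Y).
Proof.
have -> : D @^-1` Y = \bigcup_(k in Y) [set w | D w = k].
  by apply/seteqP; split => [w Yw|w [k Yk /= ->] //]; exists (D w).
by apply: fin_bigcup_measurable => //; exact: finite_finset.
Qed.

Lemma finite_factor_measurable A :
  (forall w w', D w = D w' -> A w -> A w') -> measurable A.
Proof.
move=> AD.
have -> : A = D @^-1` [set k | exists2 w, A w & D w = k].
  by apply/seteqP; split => [w Aw|w [w' Aw' /AD]]; [exists w|exact].
exact: finite_preimage_measurable.
Qed.

Lemma finite_factorP (f : T -> R) : (forall w w', D w = D w' -> f w = f w') ->
  exists g : K -> R, f = g \o D.
Proof.
move=> fD.
exists (fun k => if pselect (exists w, D w = k) is left h then f (sval (cid h)) else 0).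
apply/funext => w /=; case: pselect => [h|[]]; last by exists w.
by apply: fD; rewrite (svalP (cid h)).
Qed.

Lemma finite_indicE (g : K -> R) :
  g \o D = fun w => \sum_k g k * \1_[set w | D w = k] w.
Proof.
apply/funext => w; rewrite (bigD1 (D w)) //= indicE mem_set // mulr1.
rewrite big1 ?addr0 // => k /eqP kD; rewrite indicE memNset ?mulr0 //.
by move=> /= /esym.
Qed.

Lemma integrable_finite (g : K -> R) : P.-integrable setT (EFin \o (g \o D)).
Proof.
rewrite finite_indicE.
have -> : EFin \o (fun w => \sum_k g k * \1_[set w | D w = k] w) =
   (fun w => \sum_k (g k * \1_[set w | D w = k] w)%:E)%E.
  by apply/funext => w /=; rewrite sumEFin.
apply: integrable_sum => // k _.
under eq_fun do rewrite EFinM.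
by apply: integrableZl => //; apply: integrable_prob_indic.
Qed.

Lemma Rintegral_finite (g : K -> R) :
  \int[P]_w g (D w) = \sum_k g k * prob [set w | D w = k].
Proof.
have -> : (fun w => g (D w)) = g \o D by [].
rewrite finite_indicE /Rintegral.
under eq_integral do rewrite -sumEFin.
rewrite integral_sum //; last first.
  move=> k; under eq_fun do rewrite EFinM.
  by apply: integrableZl => //; apply: integrable_prob_indic.
rewrite (eq_bigr (fun k => (g k * prob [set w | D w = k])%:E)); last first.
  move=> k _; under eq_integral do rewrite EFinM.
  rewrite integralZl //; last by apply: integrable_prob_indic.
  by rewrite integral_indic // setIT [RHS]EFinM -probE.
by rewrite sumEFin.
Qed.

Lemma prob_finite_partition A : measurable A ->
  prob A = \sum_k prob (A `&` [set w | D w = k]).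
Proof.
move=> mA.
have -> : prob A = \int[P]_w (\1_A w).
  by rewrite /Rintegral integral_indic // setIT.
rewrite /Rintegral.
under eq_integral => w _.
  have -> : \1_A w = \sum_k \1_(A `&` [set w | D w = k]) w :> R.
    rewrite (bigD1 (D w)) //= big1 ?addr0 => [|k /eqP kD].
      rewrite !indicE; congr (_%:R); congr nat_of_bool.
      by apply/idP/idP; rewrite !inE /=; [|case].
    by rewrite indicE memNset // => -[_ /= /esym].
  rewrite -sumEFin; over.
rewrite integral_sum //; last first.
  by move=> k; apply: integrable_prob_indic; apply: measurableI.
rewrite (eq_bigr (fun k => (prob (A `&` [set w | D w = k]))%:E)); last first.
  move=> k _; have mk := measurableI _ _ mA (mD k).
  by rewrite integral_indic // setIT -probE.
by rewrite sumEFin.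
Qed.

End FiniteValued.
End RealProbability.

(** * Cylinder events *)

Section AccuracyWeight.
Context {R : realType}.
Implicit Types (rho : R) (b : bool).

Lemma accuracy_weight_gt0 rho b : 0 < rho < 1 -> 0 < accuracy_weight rho b.
Proof. by case/andP=> r0 r1; case: b; rewrite //= subr_gt0. Qed.

Lemma llrE rho b : 0 < rho < 1 ->
  llr b rho = ln (accuracy_weight rho (b == true)) -
              ln (accuracy_weight rho (b == false)).
Proof.
case/andP=> r0 r1; rewrite /llr /logit ln_div ?posrE ?subr_gt0 //.
by case: b => /=; ring.
Qed.

Lemma llr_sign rho b : llr b rho = if b then logit rho else - logit rho.
Proof. by rewrite /llr; case: b => /=; ring. Qed.

Lemma logit_gt0 rho : 1 / 2 < rho < 1 -> 0 < logit rho.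
Proof.
case/andP=> r0 r1; apply: ln_gt0; rewrite ltr_pdivlMr ?mul1r ?subr_gt0 //; lra.
Qed.

Lemma logitB rho : 0 < rho < 1 -> logit rho = ln rho - ln (1 - rho).
Proof. by case/andP=> r0 r1; rewrite /logit ln_div ?posrE ?subr_gt0. Qed.

Lemma ler_logit rho rho' : 0 < rho < 1 -> 0 < rho' < 1 -> rho <= rho' ->
  logit rho <= logit rho'.
Proof.
move=> r01 r01' rr'; rewrite !logitB //; case/andP: r01 => r0 r1.
case/andP: r01' => r0' r1'; apply: lerB; rewrite ler_ln ?posrE ?subr_gt0 //.
by rewrite lerD2l lerN2.
Qed.

Lemma ltr_logit rho rho' : 0 < rho < 1 -> 0 < rho' < 1 -> rho < rho' ->
  logit rho < logit rho'.
Proof.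
move=> r01 r01' rr'; rewrite !logitB //; case/andP: r01 => r0 r1.
case/andP: r01' => r0' r1'; apply: ltrB; rewrite ltr_ln ?posrE ?subr_gt0 //.
by rewrite ltrD2l ltrN2.
Qed.

Lemma normr_llr rho b : 1 / 2 < rho < 1 -> `|llr b rho| = logit rho.
Proof.
by move=> /logit_gt0 /ltW r0; rewrite llr_sign; case: b; rewrite ?normrN ger0_norm.
Qed.

End AccuracyWeight.

Section Model.
Context {R : realType} {d : measure_display} {Omega : measurableType d}.
Variable M : cascade_model R Omega.
Implicit Types (i j n N : nat) (w : Omega) (E : set Omega).

Local Notation pr := (prob (law M)).
Local Notation state_is t := [set w | state M w = t].

Lemma measurable_bool_eq (X : {RV (law M) >-> bool}) b :
  measurable [set w | X w = b].
Proof. exact: (measurable_funPTI X (Y := [set b])). Qed.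

Lemma prob_state t : pr (state_is t) = accuracy_weight (pi0 M) t.
Proof.
have pT : pr (state_is true) = pi0 M by rewrite /prob stateE.
case: t => //=; have := prob_bool (law M) (measurable_bool_eq (state M)) (@measurableT _ Omega).
by rewrite probT !setTI pT => /= ->; rewrite addrC addKr.
Qed.

Lemma prob_state_gt0 t : 0 < pr (state_is t).
Proof. rewrite prob_state; exact/accuracy_weight_gt0/pi0_itv. Qed.

Lemma cond_prob_accuracy (X : {RV (law M) >-> bool}) rho b t :
  cond_prob (law M) [set w | X w = t] (state_is t) = rho ->
  cond_prob (law M) [set w | X w = b] (state_is t) = accuracy_weight rho (b == t).
Proof.
move=> Xt; have [->//|bt] := eqVneq b t; rewrite -Xt /= /cond_prob -!/(pr _).
have /gt_eqF/negbT st0 := prob_state_gt0 t.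
have := prob_bool (law M) (measurable_bool_eq X) (measurable_bool_eq (state M) t).
have -> : b = ~~ t by move: bt; case: (b); case: (t).
rewrite [in X in X -> _]setIC [X in _ + pr X]setIC.
move=> H; apply/(mulIf st0); rewrite mulrBl !divfK // mul1r; move: H; clear; case: t => /= H; lra.
Qed.

Definition cylinder (x : bool) (v : nat -> bool) n : set Omega :=
  [set w | AI M w = x /\ forall i, (i < n)%N -> signal M i w = v i].

Definition likelihood (x : bool) (v : nat -> bool) n (t : bool) : R :=
  accuracy_weight (alpha M) (x == t) *
  \prod_(i < n) accuracy_weight (q M) (v i == t).

(** The product rule of the model for the index list made of [None] and the first [n] users,
    multiplied by the prior weight of the state. *)
Lemma prob_cylinder x v n t :
  pr (cylinder x v n `&` state_is t) =
  accuracy_weight (pi0 M) t * likelihood x v n t.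
Proof.
pose I := None :: map Some (iota 0 n).
pose u (k : option nat) := if k is Some i then v i else x.
have uI : uniq I.
  rewrite /I /= map_inj_uniq ?iota_uniq ?andbT; last by move=> ? ? [].
  by apply/negP => /mapP[].
have := signals_indep M t u uI.
rewrite {1}/cond_prob.
have -> : [set w | forall k, k \in I ->
    (if k is Some i then signal M i w else AI M w) = u k] = cylinder x v n.
  apply/seteqP; split => [w H|w [H1 H2] [i|//]].
    split; first exact: (H None (mem_head _ _)).
    move=> i ni; apply: (H (Some i)).
    by rewrite inE /= map_f // mem_iota.
  rewrite inE /= mem_map ?mem_iota /= => [/H2//|? ? []//].
rewrite -/(pr _) -/(pr (state_is t)) big_cons big_map.
rewrite (cond_prob_accuracy _ (AI_accuracy M t)).
under eq_bigr do rewrite (cond_prob_accuracy _ (signal_accuracy M _ t)).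
have -> : iota 0 n = index_iota 0 n by rewrite /index_iota subn0.
rewrite big_mkord -/(likelihood x v n t) -prob_state => <-.
by rewrite mulrCA divff ?mulr1 // gt_eqF // prob_state_gt0.
Qed.

Lemma measurable_cylinder x v n : measurable (cylinder x v n).
Proof.
elim: n => [|n IH].
  rewrite (_ : cylinder x v 0 = [set w | AI M w = x]); first exact: measurable_bool_eq.
  by apply/seteqP; split => [w []|w].
rewrite (_ : cylinder x v n.+1 = cylinder x v n `&` [set w | signal M n w = v n]).
  by apply: measurableI => //; exact: measurable_bool_eq.
apply/seteqP; split => [w [wx H]|w [[wx H] wn]].
  by split; [split=> // i /ltnW; exact: H|exact: H].
by split => // i; rewrite ltnS leq_eqVlt => /predU1P[->//|/H].
Qed.

Definition coords n w : bool * n.-tuple bool :=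
  (AI M w, [tuple signal M i w | i < n]).

Lemma coordsP n w w' : coords n w = coords n w' <->
  AI M w = AI M w' /\ (forall i, (i < n)%N -> signal M i w = signal M i w').
Proof.
split=> [H|[H1 H2]].
  split=> [|i ni]; first exact: (congr1 fst H).
  by have := congr1 (fun k => tnth k.2 (Ordinal ni)) H; rewrite !tnth_mktuple.
by congr pair; [|apply: eq_from_tnth => i; rewrite !tnth_mktuple H2].
Qed.

Lemma coords_le m n w w' : (m <= n)%N -> coords n w = coords n w' ->
  coords m w = coords m w'.
Proof.
move=> mn /coordsP[H1 H2]; apply/coordsP; split=> // i im.
by apply: H2; apply: leq_trans mn.
Qed.

Lemma coords_fiber n w :
  [set w' | coords n w' = coords n w] = cylinder (AI M w) (fun i => signal M i w) n.
Proof. by apply/seteqP; split => w' /= /coordsP. Qed.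

Lemma measurable_coords n (k : bool * n.-tuple bool) :
  measurable [set w | coords n w = k].
Proof.
have [[w <-]|H] := pselect (exists w, coords n w = k).
  by rewrite coords_fiber; exact: measurable_cylinder.
by rewrite (_ : [set _ | _] = set0) // -subset0 => w wk; apply: H; exists w.
Qed.

(** Plays the role of measurability with respect to the AI signal and the first [n] signals. As
    [coords n] takes finitely many values, constancy on its fibers already yields measurability and,
    for real functions, integrability. *)
Definition determined (X : Type) n (f : Omega -> X) : Prop :=
  forall w w', coords n w = coords n w' -> f w = f w'.

Lemma determined_set n E : determined n E -> 
  forall w w', coords n w = coords n w' -> E w -> E w'.
Proof. by move=> H w w' /H ->. Qed.

Lemma measurable_determined n E : determined n E -> measurable E.
Proof.
move=> /determined_set; exact/finite_factor_measurable/measurable_coords.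
Qed.

(** Given the state, the signal of index [n] is independent of the earlier coordinates. On each
    fiber of [coords n] the claim compares a cylinder of length [n] with one of length [n.+1]. *)
Lemma prob_determined_signal n E b t : determined n E ->
  pr (E `&` [set w | signal M n w = b] `&` state_is t) =
  accuracy_weight (q M) (b == t) * pr (E `&` state_is t).
Proof.
move=> En; have mE := measurable_determined En.
have mt := measurable_bool_eq (state M) t.
have mb := measurable_bool_eq (signal M n) b.
rewrite (prob_finite_partition _ (@measurable_coords n) (measurableI _ _ mE mt)).
rewrite (prob_finite_partition _ (@measurable_coords n)
  (measurableI _ _ (measurableI _ _ mE mb) mt)).
rewrite mulr_sumr; apply: eq_bigr => k _.
have [[w [Ew wk]]|H] := pselect (exists w, E w /\ coords n w = k); last first.
  rewrite (_ : _ `&` _ = set0); last first.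
    by rewrite -subset0 => w [[[Ew _] _] wk]; apply: H; exists w.
  rewrite (_ : _ `&` _ = set0) ?prob0 ?mulr0 //.
  by rewrite -subset0 => w [[Ew _] wk]; apply: H; exists w.
have -> : E `&` state_is t `&` [set w' | coords n w' = k] =
    cylinder (AI M w) (fun i => signal M i w) n `&` state_is t.
  rewrite -coords_fiber wk; apply/seteqP; split => [w' [[]]//|w' [/= w'k w't]].
  by split=> //; split=> //; apply: (determined_set En _ Ew); rewrite wk.
pose v i := if i == n then b else signal M i w.
have -> : E `&` [set w' | signal M n w' = b] `&` state_is t `&`
    [set w' | coords n w' = k] = cylinder (AI M w) v n.+1 `&` state_is t.
  apply/seteqP; split => [w' [[[Ew' w'b] w't] w'k]|w' [[w'x w'v] w't]].
    split=> //; move: w'k; rewrite /= -wk => /coordsP[? H]; split=> // i.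
    rewrite ltnS leq_eqVlt /v => /predU1P[->|in_]; first by rewrite eqxx.
    by rewrite ltn_eqF // H.
  have w'k : coords n w' = coords n w.
    apply/coordsP; split=> // i in_; rewrite w'v 1?ltnW // /v ltn_eqF //.
  split; last by rewrite /= w'k.
  split=> //; split; last by rewrite /= w'v // /v eqxx.
  by apply: (determined_set En _ Ew).
rewrite !prob_cylinder /likelihood big_ord_recr /= {2}/v eqxx.
under eq_bigr => i _ do rewrite /v ltn_eqF //.
by rewrite mulrCA !mulrA; ring.
Qed.

Lemma measurable_fun_determined (d' : measure_display) (X : measurableType d')
    n (f : Omega -> X) : determined n f -> measurable_fun setT f.
Proof.
move=> fn _ Y _; rewrite setTI; apply: (@measurable_determined n).
by move=> w w' /fn; rewrite /preimage /= => ->.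
Qed.

Lemma prob_state_split E : measurable E ->
  pr E = pr (E `&` state_is true) + pr (E `&` state_is false).
Proof. by move=> mE; apply: prob_bool => // b; exact: measurable_bool_eq. Qed.

End Model.

(** * The cascade and the external observers *)

Section Dynamics.
Context {R : realType} {d : measure_display} {Omega : measurableType d}.
Variable M : cascade_model R Omega.
Hypotheses (q_itv : 1 / 2 < q M < 1) (alpha_itv : 1 / 2 < alpha M < 1).
Implicit Types (i j n N : nat) (w : Omega).

Local Notation pr := (prob (law M)).
Local Notation state_is t := [set w | state M w = t].
Local Notation Lq := (logit (q M)).

Let q01 : 0 < q M < 1. Proof. by move: q_itv; lra. Qed.
Let alpha01 : 0 < alpha M < 1. Proof. by move: alpha_itv; lra. Qed.
Let Lq_gt0 : 0 < Lq. Proof. exact: logit_gt0. Qed.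

(** * The public log-odds as a walk frozen at the cascade *)

Definition stopped i w : bool := Lq <= `|public M i w|.

Lemma determined_public i : determined M i (public M i).
Proof.
elim: i => [|i IH] w w' cw; first by case/coordsP: cw => /= ->.
have p : public M i w = public M i w' by apply: IH; apply: coords_le cw.
have s : signal M i w = signal M i w' by case/coordsP: cw => _; apply.
by rewrite /= /judgment_llr p s.
Qed.

Lemma determined_public_le i n : (i <= n)%N -> determined M n (public M i).
Proof. by move=> le_in w w' /(coords_le le_in); exact: determined_public. Qed.

Lemma determined_stopped i : determined M i (stopped i).
Proof. by move=> w w' cw; rewrite /stopped (determined_public cw). Qed.

(** When [|p|] equals [L_q], an opposing signal produces a tie, which is resolved by the sign of
    [p]; the boundary thus belongs to the cascade. *)
Lemma decideE (p : R) (x : bool) :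
  decide M p x = if Lq <= `|p| then 0 <= p else x.
Proof.
have L0 := Lq_gt0; rewrite /decide llr_sign.
have [p0|p0] := ltP p 0; [rewrite ltr0_norm // | rewrite ger0_norm //].
  by case: x; (case: (ltP 0) => h1; [|case: (ltP _ 0) => h2]);
    case: (leP Lq) => h3 //; exfalso; lra.
by case: x; (case: (ltP 0) => h1; [|case: (ltP _ 0) => h2]);
  case: (leP Lq) => h3 //; exfalso; lra.
Qed.

Lemma judgmentE i w :
  judgment M i w = if stopped i w then 0 <= public M i w else signal M i w.
Proof. exact: decideE. Qed.

(** The event contains the cylinder of the realized coordinates, which has positive mass under
    either state. The conditional probabilities in [judgment_llr] are therefore genuine, at every
    [w]. *)
Lemma prob_history_gt0 i w t :
  0 < pr (state_is t `&` [set w' | public M i w' = public M i w]).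
Proof.
apply: (@lt_le_trans _ _
    (pr (cylinder M (AI M w) (fun i => signal M i w) i `&` state_is t))).
  rewrite prob_cylinder !mulr_gt0 ?accuracy_weight_gt0 ?pi0_itv //.
  by apply: prodr_gt0 => j _; exact: accuracy_weight_gt0.
have mt := measurable_bool_eq (state M) t.
apply: prob_le.
- by apply: measurableI => //; exact: measurable_cylinder.
- apply: measurableI => //; apply: (@measurable_determined _ _ _ M i).
  by move=> w1 w2 /determined_public /= ->.
- rewrite -coords_fiber => w' [w'w w't]; split=> //=.
  by apply: determined_public w'w.
Qed.

(** After the cascade the judgment is constant on the conditioning event; before it, the judgment is
    the signal, which is independent of the past given the state. *)
Lemma cond_prob_judgment i w t :
  cond_prob (law M) [set w' | judgment M i w' = judgment M i w]
    [set w' | state M w' = t /\ public M i w' = public M i w] =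
  if stopped i w then 1 else accuracy_weight (q M) (signal M i w == t).
Proof.
rewrite /cond_prob -!/(pr _).
have -> : [set w' | state M w' = t /\ public M i w' = public M i w] =
  state_is t `&` [set w' | public M i w' = public M i w] by [].
have := prob_history_gt0 i w t; set B := _ `&` _ => /gt_eqF/negbT B0.
have stE w' : B w' -> stopped i w' = stopped i w.
  by case=> _; rewrite /stopped => /= ->.
case: ifPn => sw.
  rewrite (_ : _ `&` B = B) ?divff //.
  apply/seteqP; split => [w' []//|w' Bw']; split=> //=.
  by rewrite !judgmentE stE // sw; case: Bw' => _ /= ->.
apply/(mulIf B0); rewrite divfK // {2}/B setIC.
rewrite (setIC (state_is t)) -(prob_determined_signal (n := i)); last first.
  by move=> w1 w2 /determined_public /= ->.
have JE w' : B w' ->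
    (judgment M i w' = judgment M i w) = (signal M i w' = signal M i w).
  by move=> Bw'; rewrite !judgmentE stE // (negbTE sw).
congr prob; apply/seteqP; split => [w' [Bw']|w' [[w'p w's] w't]].
  by rewrite /= JE //; case: Bw'.
have Bw' : B w' by [].
by split=> //=; rewrite JE.
Qed.

Lemma publicS i w : public M i.+1 w =
  public M i w + (if stopped i w then 0 else llr (signal M i w) (q M)).
Proof.
rewrite [LHS]/= -/(judgment M i) /judgment_llr !cond_prob_judgment.
case: ifP => _; first by rewrite divr1 ln1.
by rewrite ln_div ?posrE ?accuracy_weight_gt0 // -llrE.
Qed.

Lemma public_step i w : ~~ stopped i w ->
  public M i.+1 w = public M i w + (if signal M i w then Lq else - Lq).
Proof. by move=> /negbTE sw; rewrite publicS sw llr_sign. Qed.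

Lemma public_stopped i j w : stopped i w -> (i <= j)%N ->
  public M j w = public M i w.
Proof.
move=> si /subnKC <-; elim: (j - i)%N => [|k IH]; first by rewrite addn0.
by rewrite addnS publicS IH /stopped IH -/(stopped i w) si addr0.
Qed.

Lemma stopped_mono i j w : (i <= j)%N -> stopped i w -> stopped j w.
Proof. by move=> ij si; rewrite /stopped (public_stopped si ij). Qed.

(* A user who moves the public log-odds away from 0 triggers the cascade. *)
Lemma signal_unstopped i w : ~~ stopped i.+1 w ->
  signal M i w = (public M i w < 0).
Proof.
move=> si1; have si : ~~ stopped i w by apply: contra si1; exact: stopped_mono.
move: si1; rewrite /stopped -ltNge (public_step si) ltr_norml.
case: (signal M i w) => /andP[lo hi]; apply/esym; first by lra.
by apply/negbTE; rewrite -leNgt; lra.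
Qed.

(** * Counting the users before the cascade *)

(** As [stopped] is monotone in time, this is the minimum of [N] and [tau - 1]. Unlike [tau], it is
    always finite and depends on finitely many signals. *)
Definition pass_count N w : nat := \sum_(i < N) ~~ stopped i w.

Lemma pass_count_le N w : (pass_count N w <= N)%N.
Proof.
rewrite /pass_count -[leqRHS]card_ord -sum1_card; apply: leq_sum => k _.
exact: leq_b1.
Qed.

Lemma pass_count_unstopped N w : ~~ stopped N w -> pass_count N w = N.
Proof.
move=> sN; rewrite /pass_count (eq_bigr (fun=> 1%N)) ?sum1_card ?card_ord //.
move=> k _; suff -> : ~~ stopped k w by [].
by apply: contra sN; apply: stopped_mono; exact: ltnW.
Qed.

Lemma pass_countS N w : pass_count N.+1 w = (pass_count N w + ~~ stopped N w)%N.
Proof. by rewrite /pass_count big_ord_recr. Qed.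

Lemma stopped_pass_count i N w : (i < N)%N ->
  (i < pass_count N w)%N = ~~ stopped i w.
Proof.
elim: N i => // N IH i; rewrite ltnS /pass_count big_ord_recr /= -/(pass_count N w).
have le_pN := pass_count_le N w.
rewrite leq_eqVlt => /predU1P[->|iN].
  have [sN|sN] := boolP (stopped N w); first by rewrite addn0 ltnNge le_pN.
  by rewrite (pass_count_unstopped sN) addn1 ltnSn.
have [sN|sN] := boolP (stopped N w); first by rewrite addn0 IH.
have si : ~~ stopped i w by apply: contra sN; apply: stopped_mono; exact: ltnW.
by rewrite si addn1 ltnS ltnW // IH.
Qed.

Lemma pass_count_le_stopped i N w : stopped i w -> (pass_count N w <= i)%N.
Proof.
move=> si; rewrite leqNgt; apply/negP => iN.
by have := stopped_pass_count w (leq_trans iN (pass_count_le N w)); rewrite iN si.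
Qed.

Lemma ltr_tau i w : ((i.+1)%:R%:E < tau M w)%E = ~~ stopped i w.
Proof.
have [si|si] := boolP (stopped i w).
  apply/negbTE; rewrite -leNgt; apply: ereal_inf_lbound.
  by exists i.
(* Index [i] is user number [i.+1]; if she is not stopped, the first stopped user has number at
   least [i.+2]. *)
apply: (@lt_le_trans _ _ (i.+2)%:R%:E); first by rewrite lte_fin ltr_nat.
apply: le_ereal_inf_tmp => _ [j /= sj <-]; rewrite lee_fin ler_nat ltnS ltnNge.
by apply: contra si => ji; exact: stopped_mono sj.
Qed.

Lemma prefix_signalsE N w : prefix_signals M N w =
  [seq signal M i w | i <- iota 0 (pass_count N w)].
Proof.
rewrite /prefix_signals; congr map.
have -> : iota 0 (pass_count N w) = [seq i <- iota 0 N | (i < pass_count N w)%N].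
  have := pass_count_le N w; move: (pass_count N w) => k kN.
  rewrite -(subnKC kN) iotaD filter_cat add0n.
  rewrite (all_filterP _); last by apply/allP => i; rewrite mem_iota.
  rewrite (eq_in_filter (a2 := pred0)) ?filter_pred0 ?cats0 // => i.
  by rewrite mem_iota => /andP[ki _]; rewrite /= ltnNge ki.
apply: eq_in_filter => i; rewrite mem_iota /= add0n => iN.
by rewrite ltr_tau stopped_pass_count.
Qed.

Lemma size_prefix_signals N w : size (prefix_signals M N w) = pass_count N w.
Proof. by rewrite prefix_signalsE size_map size_iota. Qed.

Lemma pass_count_le_tau N w : ((pass_count N w)%:R%:E <= tau M w - 1)%E.
Proof.
rewrite leeBrDr // -EFinD natr1; apply: le_ereal_inf_tmp => _ [j /= sj <-].
by rewrite lee_fin ler_nat ltnS pass_count_le_stopped.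
Qed.

(** Tail-sum form of the delay: it turns the mean into the series of survival probabilities by
    monotone convergence, and it gives the measurability of [tau]. *)
Lemma tau_sub1E w :
  (tau M w - 1 = \sum_(0 <= j <oo) ((~~ stopped j w)%:R : R)%:E)%E.
Proof.
have psE N : (\sum_(0 <= j < N) ((~~ stopped j w)%:R : R)%:E =
    (pass_count N w)%:R%:E :> \bar R)%E.
  by rewrite sumEFin big_mkord /pass_count natr_sum.
have ge0 j : (0 <= ((~~ stopped j w)%:R : R)%:E)%E by rewrite lee_fin.
apply/eqP; rewrite eq_le; apply/andP; split; last first.
  apply: lime_le; first by apply: is_cvg_nneseries => *; exact: ge0.
  by apply: nearW => N; rewrite psE pass_count_le_tau.
have ps_le N : ((pass_count N w)%:R%:E <=
    \sum_(0 <= j <oo) ((~~ stopped j w)%:R : R)%:E)%E.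
  by rewrite -psE; apply: nneseries_lim_ge => *; exact: ge0.
have [ex_stop|ns] := pselect (exists m, stopped m w).
  case: (@ex_minnP (fun m => stopped m w) ex_stop) => m sm m_min.
  apply: le_trans (ps_le m); rewrite leeBlDr // -EFinD.
  suff -> : pass_count m w = m by rewrite natr1; apply: ereal_inf_lbound; exists m.
  rewrite /pass_count (eq_bigr (fun=> 1%N)) ?sum1_card ?card_ord // => k _.
  suff -> : ~~ stopped k w by [].
  by apply/negP => /m_min; rewrite leqNgt ltn_ord.
(* Without a cascade the partial sums are the integers [N], hence unbounded. *)
suff -> : (\sum_(0 <= j <oo) ((~~ stopped j w)%:R : R)%:E = +oo)%E by rewrite leey.
apply/eqyP => r r0; apply: le_trans (ps_le (Num.truncn r).+1); rewrite lee_fin.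
rewrite /pass_count (eq_bigr (fun=> 1%N)) ?sum1_card ?card_ord => [|k _].
  by rewrite ltW // truncnS_gt.
suff -> : ~~ stopped k w by [].
by apply/negP => sk; apply: ns; exists k.
Qed.

(** * Finite mean of the delay *)

Lemma integrable_determined n (f : Omega -> R) : determined M n f ->
  (law M).-integrable setT (EFin \o f).
Proof.
move=> /finite_factorP[g ->]; apply: integrable_finite; exact: measurable_coords.
Qed.

(** Given either state, a signal value has probability [q] or [1 - q], and [q] is the larger of the
    two. *)
Lemma prob_determined_signal_le n (E : set Omega) b : determined M n E ->
  pr (E `&` [set w | signal M n w = b]) <= q M * pr E.
Proof.
move=> En; have mE := measurable_determined En.
rewrite (prob_state_split M mE) (prob_state_split M (measurableI _ _ mE _));
  last exact: measurable_bool_eq.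
rewrite !prob_determined_signal // mulrDr.
by apply: lerD; apply: ler_wpM2r; rewrite ?prob_ge0 //; case: b => /=;
  move: q_itv; lra.
Qed.

Lemma measurable_unstopped n : measurable [set w | ~~ stopped n w].
Proof.
by apply: (@measurable_determined _ _ _ M n) => w w' /determined_stopped /= ->.
Qed.

Lemma prob_unstopped_le n : pr [set w | ~~ stopped n w] <= q M ^+ n.
Proof.
elim: n => [|n IH].
  by rewrite expr0 -(probT (law M)); apply: prob_le => //; exact: measurable_unstopped.
(* Survival of one more step forces the signal to be [true] on [E true] and [false] on [E false];
   both events depend on the past only, so the step costs a factor [q]. *)
pose E b := [set w | ~~ stopped n w && ((public M n w < 0) == b)].
have En b : determined M n (E b).
  by move=> w w' cw; rewrite /E /= (determined_stopped cw) (determined_public cw).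
have mE b := measurable_determined (En b).
have ms b := measurable_bool_eq (signal M n) b.
have mEs b := measurableI _ _ (mE b) (ms b).
have q0 : 0 <= q M by move: q01; lra.
apply: (@le_trans _ _ (pr ((E true `&` [set w | signal M n w = true]) `|`
                           (E false `&` [set w | signal M n w = false])))).
  apply: prob_le; [exact: measurable_unstopped|exact: measurableU|].
  move=> w /= sw1; have s := signal_unstopped sw1.
  have sw : ~~ stopped n w by apply: contra sw1; exact: stopped_mono.
  case p : (public M n w < 0) s => s; [left|right]; split => //.
    by rewrite /E /= sw p.
  by rewrite /E /= sw p.
rewrite probU //; last by rewrite -subset0 => w [[_ /= s] [_ /=]]; rewrite s.
apply: le_trans (lerD (prob_determined_signal_le _ (En true))
  (prob_determined_signal_le _ (En false))) _.
rewrite -mulrDr exprS ler_wpM2l // (le_trans _ IH) // -probU //; last first.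
  by rewrite -subset0 => w [/= /andP[_ /eqP p] /andP[_ /eqP]]; rewrite p.
by apply: prob_le; [exact: measurableU|exact: measurable_unstopped|move=> w /= [] /andP[]].
Qed.

Lemma expected_delayE : expected_delay M =
  (\sum_(0 <= j <oo) (pr [set w | ~~ stopped j w])%:E)%E.
Proof.
rewrite /expected_delay; under eq_integral do rewrite tau_sub1E.
have dU j : determined M j (fun w => (~~ stopped j w)%:R : R).
  by move=> w w' /determined_stopped ->.
rewrite integral_nneseries //; last first.
  by move=> n; exact: (measurable_int _ (integrable_determined (dU n))).
apply: eq_eseriesr => j _.
rewrite -probE; last exact: measurable_unstopped.
rewrite -[in RHS](setIT [set w | _]) -integral_indic //; last exact: measurable_unstopped.
by apply: eq_integral => w _; rewrite indicE; congr (_%:R%:E); congr nat_of_bool;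
  apply/idP/idP; rewrite inE.
Qed.

Lemma expected_delay_fin_num : expected_delay M \is a fin_num.
Proof.
rewrite ge0_fin_numE; last first.
  rewrite expected_delayE; apply: nneseries_ge0 => *; by rewrite lee_fin prob_ge0.
have q1 : 0 < 1 - q M by move: q01; lra.
(* The sum of the geometric series that dominates the survival probabilities. *)
apply: (@le_lt_trans _ _ (1 - q M)^-1%:E); last by rewrite ltry.
rewrite expected_delayE; apply: lime_le.
  by apply: is_cvg_nneseries => *; rewrite lee_fin prob_ge0.
apply: nearW => N; rewrite sumEFin lee_fin big_mkord.
apply: (@le_trans _ _ (\sum_(i < N) q M ^+ i)).
  by apply: ler_sum => i _; exact: prob_unstopped_le.
rewrite -[leRHS]mul1r ler_pdivlMr //.
have := subrX1 (q M) N; have : 0 <= q M ^+ N by rewrite exprn_ge0 //; move: q01; lra.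
lra.
Qed.

Definition mean_delay : R := fine (expected_delay M).

Lemma determined_pass_count n N (f : nat -> R) : (N <= n.+1)%N ->
  determined M n (fun w => f (pass_count N w)).
Proof.
move=> Nn w w' cw; rewrite /pass_count; congr f; apply: eq_bigr => i _.
rewrite (determined_stopped (coords_le _ cw)) //.
by rewrite -ltnS (leq_trans (ltn_ord i)).
Qed.

Lemma mean_pass_count_le N : \int[law M]_w (pass_count N w)%:R <= mean_delay.
Proof.
have dN : determined M N (fun w => (pass_count N w)%:R : R).
  exact: (determined_pass_count (fun k => k%:R) (leqnSn N)).
apply: fine_le; [|exact: expected_delay_fin_num|].
  exact: (integrable_fin_num measurableT (integrable_determined dN)).
apply: ge0_le_integral => //.
- exact: (measurable_int _ (integrable_determined dN)).
- under eq_fun do rewrite tau_sub1E.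
  apply: (ge0_emeasurable_sum (P := predT)) => [n w _ _|n _].
    by rewrite lee_fin.
  apply: (measurable_int _ (integrable_determined (n := n) _)).
  by move=> w w' /determined_stopped ->.
- by move=> w _; exact: pass_count_le_tau.
Qed.

(** * Posterior log-odds of an observed cylinder *)

Lemma public_sum N w : public M N w = prior_logodds M + llr (AI M w) (alpha M) +
  \sum_(i < pass_count N w) llr (signal M i w) (q M).
Proof.
elim: N => [|N IH]; first by rewrite /pass_count !big_ord0 addr0.
rewrite publicS pass_countS IH; case: ifPn => sN; first by rewrite addn0 addr0.
by rewrite addn1 big_ord_recr /= addrA (pass_count_unstopped sN).
Qed.

Lemma big_prefix (X : Type) (idx : X) (op : X -> X -> X) (f : bool -> X) N w :
  \big[op/idx]_(b <- prefix_signals M N w) f b =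
  \big[op/idx]_(i < pass_count N w) f (signal M i w).
Proof.
rewrite prefix_signalsE big_map.
have -> n : iota 0 n = index_iota 0 n by rewrite /index_iota subn0.
by rewrite big_mkord.
Qed.

Lemma likelihood_gt0 x v n t : 0 < likelihood M x v n t.
Proof.
by rewrite mulr_gt0 ?accuracy_weight_gt0 // prodr_gt0 // => j _;
  exact: accuracy_weight_gt0.
Qed.

(** Bayes' rule: likelihoods of conditionally independent signals multiply, so their log-likelihood
    ratios add to the prior log-odds. *)
Lemma ln_likelihood_ratio x v n :
  ln (accuracy_weight (pi0 M) true * likelihood M x v n true /
      (accuracy_weight (pi0 M) false * likelihood M x v n false)) =
  prior_logodds M + llr x (alpha M) + \sum_(i < n) llr (v i) (q M).
Proof.
have w0 t : 0 < accuracy_weight (pi0 M) t by apply/accuracy_weight_gt0/pi0_itv.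
have wl0 t : 0 < accuracy_weight (pi0 M) t * likelihood M x v n t.
  exact: mulr_gt0 (w0 t) (likelihood_gt0 x v n t).
rewrite ln_div ?posrE //.
have lnE t : ln (accuracy_weight (pi0 M) t * likelihood M x v n t) =
    ln (accuracy_weight (pi0 M) t) + ln (likelihood M x v n t).
  by rewrite lnM ?posrE ?likelihood_gt0.
rewrite !lnE opprD addrACA.
have -> : ln (accuracy_weight (pi0 M) true) - ln (accuracy_weight (pi0 M) false) =
    prior_logodds M by rewrite -ln_div ?posrE.
rewrite -addrA; congr (_ + _).
move=> {lnE wl0}.
elim: n => [|n IH]; first by rewrite /likelihood !big_ord0 !mulr1 addr0 llrE.
have lnE t : ln (likelihood M x v n.+1 t) =
    ln (likelihood M x v n t) + ln (accuracy_weight (q M) (v n == t)).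
  rewrite {1}/likelihood big_ord_recr mulrA -/(likelihood M x v n t).
  by rewrite lnM ?posrE ?likelihood_gt0 ?accuracy_weight_gt0.
by rewrite !lnE big_ord_recr opprD addrACA IH -llrE //= addrA.
Qed.

(** * Atoms: the AI signal together with the pre-cascade prefix *)

Section Atoms.
Variable N : nat.

(** The prefix has random length; pairing a length of at most [N] with a tuple of that length keeps
    the type finite. *)
Definition atom_type : finType := (bool * {n : 'I_N.+1 & n.-tuple bool})%type.

Definition atom_prefix (k : atom_type) : seq bool := tval (tagged k.2).

Lemma atom_type_inj (k k' : atom_type) :
  k.1 = k'.1 -> atom_prefix k = atom_prefix k' -> k = k'.
Proof.
case: k k' => [b [n t]] [b' [n' t']] /= ->; rewrite /atom_prefix /= => tt'.
have nn' : n = n' by apply: val_inj; rewrite /= -(size_tuple t) tt' size_tuple.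
by subst n'; congr (_, Tagged _ _); exact: val_inj.
Qed.

Lemma size_prefix_lt w : (size (prefix_signals M N w) < N.+1)%N.
Proof. by rewrite size_prefix_signals ltnS pass_count_le. Qed.

Definition atom w : atom_type :=
  (AI M w, Tagged (fun n : 'I_N.+1 => n.-tuple bool)
    (in_tuple (prefix_signals M N w) : (Ordinal (size_prefix_lt w)).-tuple bool)).

Lemma atomP w k : atom w = k <->
  AI M w = k.1 /\ prefix_signals M N w = atom_prefix k.
Proof. by split=> [<-//|[? ?]]; apply: atom_type_inj. Qed.

(** The walk reads the signal of a user only while she is not stopped, that is, only at indices
    below [pass_count N w]. *)
Lemma public_cylinder w w' :
  cylinder M (AI M w) (fun i => signal M i w) (pass_count N w) w' ->
  forall i, (i <= N)%N -> public M i w' = public M i w.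
Proof.
case=> [ww' sww']; elim=> [|i IH] iN; first by rewrite /= ww'.
have Hi := IH (ltnW iN); rewrite !publicS Hi /stopped Hi -/(stopped i w).
by case: ifPn => // si; rewrite sww' // stopped_pass_count.
Qed.

(** Sharing the AI signal and the prefix of [w] forces the cascade at the same time, so an atom is a
    cylinder whose length is that of its own prefix. *)
Lemma atom_fiber w : [set w' | atom w' = atom w] =
  cylinder M (AI M w) (fun i => signal M i w) (pass_count N w).
Proof.
apply/seteqP; split => w' /=.
  move=> /atomP[/= ? pw]; split=> // i iw.
  have pc : pass_count N w' = pass_count N w.
    by rewrite -!size_prefix_signals pw.
  move: pw; rewrite /atom_prefix /= !prefix_signalsE pc.
  move=> /(congr1 (fun s => nth false s i)).
  by rewrite !(nth_map 0%N) ?size_iota // nth_iota.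
move=> w'w; apply/atomP; case: (w'w) => /= ? sw; split=> //.
have pE := public_cylinder w'w.
have pc : pass_count N w' = pass_count N w.
  by apply: eq_bigr => i _; rewrite /stopped pE // ltnW.
rewrite /atom_prefix /= !prefix_signalsE pc; apply/eq_in_map => i.
by rewrite mem_iota /= add0n; exact: sw.
Qed.

Lemma measurable_atom k : measurable [set w | atom w = k].
Proof.
have [[w <-]|H] := pselect (exists w, atom w = k).
  by rewrite atom_fiber; exact: measurable_cylinder.
by rewrite (_ : [set _ | _] = set0) // -subset0 => w wk; apply: H; exists w.
Qed.

Lemma atom_public w w' i : atom w' = atom w -> (i <= N)%N ->
  public M i w' = public M i w.
Proof.
move=> w'w; apply: public_cylinder.
by rewrite -atom_fiber.
Qed.

Lemma atom_judgment w w' i : atom w' = atom w -> (i < N)%N ->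
  judgment M i w' = judgment M i w.
Proof.
move=> w'w iN; have pE := atom_public w'w (ltnW iN).
rewrite !judgmentE /stopped pE -/(stopped i w); case: ifPn => // si.
have : [set w'' | atom w'' = atom w] w' by [].
by rewrite atom_fiber => -[_]; apply; rewrite stopped_pass_count.
Qed.

Lemma prob_atom w t : pr ([set w' | atom w' = atom w] `&` state_is t) =
  accuracy_weight (pi0 M) t *
  likelihood M (AI M w) (fun i => signal M i w) (pass_count N w) t.
Proof. by rewrite atom_fiber prob_cylinder. Qed.

(** This identifies [public] as a true Bayesian posterior, which is what the Jensen argument
    averages. *)
Lemma atom_logodds w :
  ln (pr ([set w' | atom w' = atom w] `&` state_is true) /
      pr ([set w' | atom w' = atom w] `&` state_is false)) = public M N w.
Proof. by rewrite !prob_atom ln_likelihood_ratio public_sum. Qed.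

Lemma determined_judgment i : (i < N)%N -> determined M N (judgment M i).
Proof.
move=> iN w w' cw; rewrite /judgment (determined_public_le (ltnW iN) cw).
by case/coordsP: cw => _ ->.
Qed.

Definition judgments w : N.-tuple bool := [tuple judgment M i w | i < N].

Lemma judgmentsP w w' : judgments w' = judgments w <->
  same_judgments M N w w'.
Proof.
split=> [H i iN|H].
  by have := congr1 (fun t => tnth t (Ordinal iN)) H; rewrite !tnth_mktuple.
by apply: eq_from_tnth => i; rewrite !tnth_mktuple H.
Qed.

Lemma same_judgmentsE w : same_judgments M N w = [set w' | judgments w' = judgments w].
Proof. by apply/seteqP; split => w' /judgmentsP. Qed.

Lemma determined_judgments : determined M N judgments.
Proof.
by move=> w w' cw; apply/judgmentsP => i iN; exact: (determined_judgment iN cw).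
Qed.

Lemma measurable_judgments u : measurable [set w | judgments w = u].
Proof.
by apply: (@measurable_determined _ _ _ M N) => w w' /determined_judgments /= ->.
Qed.

Lemma prob_same_judgments_gt0 w t :
  0 < pr (same_judgments M N w `&` state_is t).
Proof.
have mt := measurable_bool_eq (state M) t.
apply: (@lt_le_trans _ _ (pr ([set w' | atom w' = atom w] `&` state_is t))).
  by rewrite prob_atom mulr_gt0 ?likelihood_gt0 // accuracy_weight_gt0 // pi0_itv.
apply: prob_le; first by apply: measurableI => //; exact: measurable_atom.
  by rewrite same_judgmentsE; apply: measurableI => //; exact: measurable_judgments.
by apply: setSI => w' ww' i; exact: atom_judgment.
Qed.

Lemma correct_logoddsE w : correct_logodds M N w =
  ln (pr (same_judgments M N w `&` state_is true) /
      pr (same_judgments M N w `&` state_is false)).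
Proof.
have S0 : pr (same_judgments M N w) != 0.
  rewrite (prob_state_split M); last first.
    by rewrite same_judgmentsE; exact: measurable_judgments.
  by rewrite gt_eqF // addr_gt0 // prob_same_judgments_gt0.
rewrite /correct_logodds /cond_prob -!/(pr _) !(setIC (state_is _)).
by rewrite invf_div mulrA divfK.
Qed.

Lemma determined_correct_logodds : determined M N (correct_logodds M N).
Proof.
move=> w w' cw; rewrite !correct_logoddsE !same_judgmentsE.
by rewrite (determined_judgments cw).
Qed.

(* Conditional Jensen inequality: the external observer averages, over the atoms
   compatible with the judgments, the beliefs of an observer of the atoms. *)
Lemma mean_correct_le :
  \int[law M]_w `|correct_logodds M N w| <= \int[law M]_w `|public M N w|.
Proof.
have mt t := measurable_bool_eq (state M) t.
have [g gE] : exists g, (fun w => `|correct_logodds M N w|) = g \o judgments.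
  apply: finite_factorP => w w' ww'.
  by rewrite !correct_logoddsE !same_judgmentsE ww'.
have [h hE] : exists h, (fun w => `|public M N w|) = h \o atom.
  by apply: finite_factorP => w w' ww'; rewrite (atom_public ww').
rewrite gE hE !Rintegral_finite; [|exact: measurable_atom|exact: measurable_judgments].
(* The joint masses of the state [t], the judgments [u] and the atom [k]. For given [u] and [k] they
   are positive under both states or zero under both. *)
pose a t u k := pr ([set w | judgments w = u] `&` state_is t `&` [set w | atom w = k]).
have m_a t u k : measurable ([set w | judgments w = u] `&` state_is t `&`
    [set w | atom w = k]).
  apply: measurableI; last exact: measurable_atom.
  by apply: measurableI => //; exact: measurable_judgments.
(* An atom determines the judgments, so intersecting with them changes nothing. *)
have aE w t : a t (judgments w) (atom w) =
    pr ([set w' | atom w' = atom w] `&` state_is t).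
  congr prob; apply/seteqP; split => [w' [[_ ?] ?]|w' [w'w ?]]; split=> //=.
  by split=> //=; apply/judgmentsP => i iN; exact: atom_judgment.
have a_empty t u k : ~ (exists w, judgments w = u /\ atom w = k) -> a t u k = 0.
  move=> H; rewrite /a (_ : _ `&` _ = set0) ?prob0 // -subset0 => w [[? _] ?].
  by apply: H; exists w.
have a_pos t w : 0 < a t (judgments w) (atom w).
  by rewrite aE prob_atom mulr_gt0 ?likelihood_gt0 // accuracy_weight_gt0 // pi0_itv.
have sum_k t u : pr ([set w | judgments w = u] `&` state_is t) = \sum_k a t u k.
  apply: prob_finite_partition; first exact: measurable_atom.
  by apply: measurableI => //; exact: measurable_judgments.
have sum_j k : \sum_u (a true u k + a false u k) = pr [set w | atom w = k].
  rewrite (prob_finite_partition _ measurable_judgments (measurable_atom k)).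
  apply: eq_bigr => u _; rewrite (prob_state_split M (measurableI _ _ _ _)) ?/a.
  - by congr (pr _ + pr _); rewrite setIAC (setIC [set w | judgments w = u]).
  - exact: measurable_atom.
  - exact: measurable_judgments.
apply: (@le_trans _ _ (\sum_k \sum_u (a true u k + a false u k) * h k)); last first.
  by apply: ler_sum => k _; rewrite -mulr_suml sum_j mulrC.
rewrite exchange_big; apply: ler_sum => u _.
have [[w <-]|H] := pselect (exists w, judgments w = u); last first.
  rewrite (_ : [set _ | _] = set0) ?prob0 ?mulr0; last first.
    by rewrite -subset0 => w wu; apply: H; exists w.
  by apply: sumr_ge0 => k _; rewrite !a_empty ?addr0 ?mul0r // => -[w [wu _]];
    apply: H; exists w.
rewrite -[g _]/((g \o judgments) w) -gE correct_logoddsE same_judgmentsE.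
rewrite (prob_state_split M (measurable_judgments _)) !sum_k mulrC.
(* For fixed judgments, subadditivity is applied to the sum over the atoms. *)
apply: le_trans (abs_ln_div_subadditive _ _ _) _ => [k|].
  have [[w' [<- <-]]|H] := pselect (exists w', judgments w' = judgments w /\ atom w' = k).
    by right.
  by left; rewrite !a_empty.
apply: ler_sum => k _.
have [[w' [<- <-]]|H] := pselect (exists w', judgments w' = judgments w /\ atom w' = k).
  by rewrite -[h _]/((h \o atom) w') -hE -atom_logodds !aE.
by rewrite !a_empty // addr0 !mul0r.
Qed.

(** The event is the disjoint union of the atoms compatible with the judgments, and the triple sum
    in [marginal_likelihood] runs over exactly these. *)
Lemma prob_same_judgmentsE w t : pr (same_judgments M N w `&` state_is t) =
  accuracy_weight (pi0 M) t * marginal_likelihood M N w t.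
Proof.
have mt := measurable_bool_eq (state M) t.
have mS : measurable (same_judgments M N w).
  by rewrite same_judgmentsE; exact: measurable_judgments.
rewrite (prob_finite_partition _ measurable_atom (measurableI _ _ mS mt)).
rewrite /marginal_likelihood mulr_sumr.
under [RHS]eq_bigr => x _.
  rewrite (sig_big_dep (fun=> true)
    (fun n : 'I_N.+1 => fun v : n.-tuple bool => `[< produces M N w x v >])
    (fun (n : 'I_N.+1) (v : n.-tuple bool) => accuracy_weight (alpha M) (x == t) *
       \prod_(b <- v) accuracy_weight (q M) (b == t))) /= mulr_sumr.
  over.
rewrite pair_big_dep /= [RHS]big_mkcond /=; apply: eq_bigr => k _.
case: asboolP => [[w' [w'x w'v ww']]|H]; last first.
  rewrite (_ : _ `&` _ = set0) ?prob0 // -subset0 => w' [[ww' _] /atomP[w'x w'v]].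
  by apply: H; exists w'.
have <- : atom w' = k by apply/atomP.
rewrite (_ : _ `&` _ = [set w'' | atom w'' = atom w'] `&` state_is t).
  rewrite prob_atom /likelihood; congr (_ * (_ * _)).
  rewrite -[X in _ = \big[_/_]_(b <- X) _]/(prefix_signals M N w').
  by rewrite big_prefix.
apply/seteqP; split => [w'' [[_ ?] ?]//|w'' [w''w' ?]].
split=> //; split=> // i iN.
by rewrite (atom_judgment w''w') // ww'.
Qed.

(** Zero prior log-odds mean equal prior weights, which cancel in the ratio. *)
Lemma correct_logodds_marginal w : prior_logodds M = 0 ->
  correct_logodds M N w = marginal_evidence M N w.
Proof.
move=> l0; rewrite correct_logoddsE !prob_same_judgmentsE /marginal_evidence.
have /andP[p0 p1] := pi0_itv M.
have <- : accuracy_weight (pi0 M) true = accuracy_weight (pi0 M) false.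
  move: l0; rewrite /prior_logodds /logit => /eqP.
  rewrite ln_eq0 ?divr_gt0 ?subr_gt0 // => /eqP H /=.
  exact: divr1_eq.
by rewrite -mulf_div divff ?mul1r // gt_eqF.
Qed.

End Atoms.

(** * The final direction *)

Definition never_stopped : set Omega := [set w | forall i, ~~ stopped i w].

Lemma measurable_never_stopped : measurable never_stopped.
Proof.
have -> : never_stopped = \bigcap_i [set w | ~~ stopped i w].
  by apply/seteqP; split => [w H i _|w H i]; [exact: H|exact: (H i)].
by apply: bigcap_measurable => // i _; exact: measurable_unstopped.
Qed.

Lemma prob_never_stopped : pr never_stopped = 0.
Proof.
apply/eqP; rewrite eq_le prob_ge0 andbT.
have q_cvg : (q M ^+ n @[n --> \oo] --> (0 : R))%classic.
  by apply: cvg_expr; rewrite ger0_norm; move: q01; lra.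
rewrite -(cvg_lim (@Rhausdorff R) q_cvg); apply: limr_ge; first exact: cvgP q_cvg.
apply: nearW => n; apply: le_trans (prob_unstopped_le n).
apply: prob_le; [exact: measurable_never_stopped|exact: measurable_unstopped|].
by move=> w; exact.
Qed.

(* Agrees with [direction] almost surely, and avoids its junk values. *)
Definition sided w : R := if `[< exists i, Lq <= public M i w >] then 1 else -1.

Lemma normr_sided w : `|sided w| = 1.
Proof. by rewrite /sided; case: asboolP => _; rewrite ?normrN normr1. Qed.

Lemma sided_stopped i w : stopped i w -> sided w = Num.sg (public M i w).
Proof.
have L0 := Lq_gt0; move=> si; rewrite /sided; case: asboolP => [[j Lj]|H].
  have sj : stopped j w by apply: le_trans Lj (ler_norm _).
  rewrite -(public_stopped si (leq_maxl i j)) (public_stopped sj (leq_maxr i j)).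
  by rewrite gtr0_sg // (lt_le_trans L0).
have {H} iL : public M i w < Lq by rewrite ltNge; apply/negP => ?; apply: H; exists i.
rewrite ltr0_sg //; move: si; rewrite /stopped ler_normr => /orP[]; lra.
Qed.

Lemma sided_public i w : stopped i w -> public M i w * sided w = `|public M i w|.
Proof. by move=> /sided_stopped ->; rewrite mulrC -normrEsg. Qed.

Lemma direction_stopped i w : stopped i w -> direction M w = sided w.
Proof.
move=> si; apply: (lim_near_cst (@Rhausdorff R)); near=> j.
rewrite (sided_stopped si); congr Num.sg; apply: public_stopped => //.
by near: j; exact: nbhs_infty_ge.
Unshelve. all: by end_near. Qed.

Lemma direction_sided w : ~ never_stopped w -> direction M w = sided w.
Proof.
by move=> /existsNP[i /negP]; rewrite negbK; exact: direction_stopped.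
Qed.

(** Without a cascade every signal is forced by [signal_unstopped], so the whole path depends on the
    AI signal alone. Hence [direction] is measurable even where its value may be junk. *)
Lemma direction_never w w' : never_stopped w -> never_stopped w' ->
  AI M w = AI M w' -> direction M w = direction M w'.
Proof.
move=> nw nw' ww'; rewrite /direction.
suff pE i : public M i w = public M i w'.
  by congr (limn _); apply/funext => i; rewrite pE.
elim: i => [|i IH]; first by rewrite /= ww'.
by rewrite !public_step // !signal_unstopped // IH.
Qed.

Lemma measurable_sided : measurable_fun setT sided.
Proof.
apply: measurable_fun_ifT => //; apply: (measurable_fun_bool true); rewrite setTI.
rewrite (_ : _ @^-1` _ = \bigcup_i [set w | Lq <= public M i w]); last first.
  apply/seteqP; split => [w /asboolP[i iL]|w [i _ iL]]; first by exists i.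
  by apply/asboolP; exists i.
apply: bigcup_measurable => i _; apply: (@measurable_determined _ _ _ M i).
by move=> w w' /determined_public /= ->.
Qed.

Lemma measurable_direction : measurable_fun setT (direction M).
Proof.
pose g b := if pselect (exists w, never_stopped w /\ AI M w = b) is left h
  then direction M (sval (cid h)) else 0.
have -> : direction M = fun w => if `[< never_stopped w >] then g (AI M w) else sided w.
  apply/funext => w; case: asboolP => [nw|]; last exact: direction_sided.
  rewrite /g; case: pselect => [h|[]]; last by exists w.
  by case: (svalP (cid h)) => nh hw; apply: direction_never.
apply: measurable_fun_ifT; last exact: measurable_sided.
  apply: (measurable_fun_bool true); rewrite setTI.
  rewrite (_ : _ @^-1` _ = never_stopped); first exact: measurable_never_stopped.
  by apply/seteqP; split => w /asboolP.
by apply: (@measurable_fun_determined _ _ _ M _ _ 0) => w w' /coordsP[->].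
Qed.

Lemma integrable_determined_sided n (a b : Omega -> R) :
  determined M n a -> determined M n b ->
  (law M).-integrable setT (EFin \o (fun w => a w * sided w + b w)).
Proof.
move=> an bn.
have -> : EFin \o (fun w => a w * sided w + b w) =
    ((EFin \o (fun w => (a w * sided w)%R)) \+ (EFin \o b))%E by [].
apply: integrableD => //; last exact: integrable_determined bn.
apply: le_integrable (integrable_determined an) => //.
  apply/measurable_EFinP; apply: measurable_funM; last exact: measurable_sided.
  exact: measurable_fun_determined an.
by move=> w _; rewrite /= lee_fin normrM normr_sided mulr1.
Qed.

(** [direction] and [sided] can differ only on the null event [never_stopped]. *)
Lemma expectation_direction n (a b : Omega -> R) :
  determined M n a -> determined M n b ->
  'E_(law M)[(fun w => a w * direction M w + b w)%R]%E =
  (\int[law M]_w (a w * sided w + b w))%:E.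
Proof.
move=> an bn; have ab := integrable_determined_sided an bn.
rewrite unlock /Rintegral fineK; last exact: (integrable_fin_num measurableT ab).
apply: ae_eq_integral => //.
- apply/measurable_EFinP; apply: measurable_funD; last exact: measurable_fun_determined bn.
  apply: measurable_funM; last exact: measurable_direction.
  exact: measurable_fun_determined an.
- exact: (measurable_int _ ab).
- exists never_stopped; split; first exact: measurable_never_stopped.
    by have := probE (law M) measurable_never_stopped; rewrite prob_never_stopped.
  move=> w /= H; apply: contrapT => /direction_sided E; apply: H => _.
  by rewrite E.
Qed.

(** * The naive excess and its remainder *)

Definition prefix_llr N w : R := \sum_(i < pass_count N w) llr (signal M i w) (q M).

Lemma determined_pass_count_self N :
  determined M N (fun w => (pass_count N w)%:R : R).
Proof. exact: (determined_pass_count (fun k => k%:R) (leqnSn N)). Qed.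

Lemma determined_prefix_llr N : determined M N (prefix_llr N).
Proof.
have E w : prefix_llr N w = public M N w - (prior_logodds M + llr (AI M w) (alpha M)).
  by rewrite public_sum addrC addKr.
move=> w w' cw; rewrite !E (determined_public cw).
by case/coordsP: cw => ->.
Qed.

Lemma determined_naive_logodds N : determined M N (naive_logodds M N).
Proof.
move=> w w' cw; congr (_ + _); apply: eq_bigr => i _.
by rewrite (determined_judgment (ltn_ord i) cw).
Qed.

Lemma judgment_sided i w : stopped i w ->
  (2 * (judgment M i w)%:R - 1) * Lq * sided w = Lq.
Proof.
have L0 := Lq_gt0; move=> si; rewrite judgmentE si (sided_stopped si).
move: si; rewrite /stopped; have [p0|p0] := ltP (public M i w) 0.
  by move=> _; rewrite ltr0_sg //=; lra.
rewrite ger0_norm // => si; rewrite gtr0_sg; last exact: lt_le_trans si.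
by rewrite /=; lra.
Qed.

(** By induction on [N]: a stopped user adds exactly [L_q], while for an earlier user the [L_q] in
    the first term is taken back by the last one and her signal enters [prefix_llr]. *)
Lemma naive_sided N w : (naive_logodds M N w - prior_logodds M) * sided w =
  N%:R * Lq + prefix_llr N w * sided w - (pass_count N w)%:R * Lq.
Proof.
rewrite /naive_logodds addrC addKr.
elim: N => [|N IH]; first by rewrite /prefix_llr /pass_count !big_ord0 /= !mul0r subr0 addr0.
rewrite big_ord_recr mulrDl IH /= /prefix_llr pass_countS -natr1.
case: (boolP (stopped N w)) => sN; first by rewrite judgment_sided //= addn0; ring.
rewrite addn1 big_ord_recr /= (pass_count_unstopped sN) judgmentE (negbTE sN).
by rewrite -/(llr _ _) -natr1; ring.
Qed.

(** What the expected excess contains besides [N * L_q], as a real integral against [sided], so that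
    it can be bounded pointwise. *)
Definition remainder N : R := \int[law M]_w
  ((prior_logodds M + prefix_llr N w - correct_logodds M N w) * sided w
   - (pass_count N w)%:R * Lq).

Lemma determined_remainder N : determined M N
  (fun w => prior_logodds M + prefix_llr N w - correct_logodds M N w).
Proof.
by move=> w w' cw; rewrite (determined_prefix_llr cw) (determined_correct_logodds cw).
Qed.

Lemma determined_delay_cost N :
  determined M N (fun w => - ((pass_count N w)%:R * Lq)).
Proof. by move=> w w' /determined_pass_count_self ->. Qed.

Lemma integrable_remainder N : (law M).-integrable setT (EFin \o (fun w =>
  (prior_logodds M + prefix_llr N w - correct_logodds M N w) * sided w
   - (pass_count N w)%:R * Lq)).
Proof.
exact: integrable_determined_sided (@determined_remainder N) (@determined_delay_cost N).
Qed.

Lemma Rintegral_law_cst (c : R) : \int[law M]_w c = c.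
Proof. by rewrite Rintegral_cst //= -/(pr setT) probT mulr1. Qed.

Lemma integrable_law_cst (c : R) : (law M).-integrable setT (EFin \o (fun=> c)).
Proof. exact: finite_measure_integrable_cst. Qed.

Lemma integrable_law_add (f g : Omega -> R) :
  (law M).-integrable setT (EFin \o f) -> (law M).-integrable setT (EFin \o g) ->
  (law M).-integrable setT (EFin \o (fun w => f w + g w)).
Proof. by move=> fi gi; have := integrableD measurableT fi gi. Qed.

Lemma expected_excessE N : expected_excess M N = (N%:R * Lq + remainder N)%:E.
Proof.
have dn : determined M N (fun w => naive_logodds M N w - correct_logodds M N w).
  by move=> w w' cw; rewrite (determined_naive_logodds cw) (determined_correct_logodds cw).
have d0 : determined M N (fun=> 0 : R) by [].
have := expectation_direction dn d0; rewrite /expected_excess.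
under [in X in X -> _]eq_fun do rewrite addr0.
move=> ->; congr EFin.
rewrite -[X in X + _]Rintegral_law_cst -RintegralD //.
- apply: eq_Rintegral => w _.
  have := naive_sided N w; lra.
- exact: integrable_law_cst.
- exact: integrable_remainder.
Qed.

Lemma evidence_termE N : prior_logodds M = 0 ->
  evidence_term M N = (remainder N)%:E.
Proof.
move=> l0; rewrite /evidence_term /remainder.
rewrite -(expectation_direction (@determined_remainder N) (@determined_delay_cost N)).
congr ('E_(law M)[_])%E; apply/funext => w.
rewrite /prefix_excess big_prefix sumrB sumr_const card_ord -mulr_suml.
rewrite -/(prefix_llr N w) -correct_logodds_marginal // l0 -mulr_natl.
ring.
Qed.

Lemma normr_prefix_llr_le N w : `|prefix_llr N w| <= (pass_count N w)%:R * Lq.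
Proof.
apply: le_trans (ler_norm_sum _ _ _) _.
under eq_bigr do rewrite normr_llr //.
by rewrite sumr_const card_ord mulr_natl.
Qed.

Lemma normr_public_le N w : `|public M N w| <=
  `|prior_logodds M| + logit (alpha M) + (pass_count N w)%:R * Lq.
Proof.
rewrite public_sum; apply: le_trans (ler_normD _ _) _.
rewrite lerD ?normr_prefix_llr_le //.
by rewrite (le_trans (ler_normD _ _)) // lerD2l normr_llr.
Qed.

Lemma integrable_affine_pass_count (c : R) N : (law M).-integrable setT
  (EFin \o (fun w => c + (pass_count N w)%:R * Lq)).
Proof.
apply: (@integrable_determined N) => w w' /determined_pass_count_self.
by move=> ->.
Qed.

Lemma mean_affine_pass_count_le (c : R) N :
  \int[law M]_w (c + (pass_count N w)%:R * Lq) <= c + mean_delay * Lq.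
Proof.
have ip := integrable_determined (@determined_pass_count_self N).
rewrite RintegralD //; last 2 first.
- exact: integrable_law_cst.
- by apply: (@integrable_determined N) => w w' /determined_pass_count_self ->.
rewrite Rintegral_law_cst lerD2l RintegralZr // ler_wpM2r ?mean_pass_count_le //.
exact: ltW.
Qed.

Lemma integrable_norm_public N : (law M).-integrable setT
  (EFin \o (fun w => `|public M N w|)).
Proof. by apply: (@integrable_determined N) => w w' /determined_public ->. Qed.

Lemma integrable_norm_correct N : (law M).-integrable setT
  (EFin \o (fun w => `|correct_logodds M N w|)).
Proof. by apply: (@integrable_determined N) => w w' /determined_correct_logodds ->. Qed.

Lemma mean_correct_le_delay N : \int[law M]_w `|correct_logodds M N w| <=
  `|prior_logodds M| + logit (alpha M) + mean_delay * Lq.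
Proof.
apply: le_trans (mean_correct_le N) _.
apply: le_trans (mean_affine_pass_count_le _ N).
apply: le_Rintegral => //; [exact: integrable_norm_public| |].
  exact: integrable_affine_pass_count.
by move=> w _; exact: normr_public_le.
Qed.

(** A term by term bound for any prior: one [mean_delay] comes from the prefix evidence, one from
    the subtracted count, and one from the correct log-odds. *)
Lemma normr_remainder_le N : `|remainder N| <=
  (`|prior_logodds M| + (mean_delay + mean_delay) * Lq) +
  (`|prior_logodds M| + logit (alpha M) + mean_delay * Lq).
Proof.
apply: le_trans (le_normr_Rintegral _ (integrable_remainder N)) _ => //.
apply: (@le_trans _ _ (\int[law M]_w
  ((`|prior_logodds M| + (pass_count N w)%:R * Lq + (0 + (pass_count N w)%:R * Lq))
   + `|correct_logodds M N w|))).
  apply: le_Rintegral => //.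
  - exact: integrable_norm (integrable_remainder N).
  - apply: (@integrable_determined N) => w w' cw.
    by rewrite (determined_pass_count_self cw) (determined_correct_logodds cw).
  move=> w _; apply: le_trans (ler_normB _ _) _.
  rewrite normrM normr_sided mulr1.
  have := ler_normB (prior_logodds M + prefix_llr N w) (correct_logodds M N w).
  have := ler_normD (prior_logodds M) (prefix_llr N w).
  have := normr_prefix_llr_le N w.
  rewrite [X in _ + X <= _]ger0_norm; last by rewrite mulr_ge0 // ltW.
  lra.
have idc c := integrable_affine_pass_count c N.
rewrite RintegralD //; [|exact: integrable_law_add|exact: integrable_norm_correct].
apply: lerD (mean_correct_le_delay N).
rewrite RintegralD //.
have := mean_affine_pass_count_le (`|prior_logodds M|) N.
have := mean_affine_pass_count_le 0 N.
lra.
Qed.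

(* The public log-odds can disagree with the final direction only while at least
   two more users are still to act before the cascade. *)
Lemma public_disagreement N w : `|public M N w| - public M N w * sided w <=
  ((pass_count N.+2 w)%:R - (pass_count N w)%:R) * Lq.
Proof.
have L0 := Lq_gt0.
have pc_ge : 0 <= (pass_count N.+2 w)%:R - (pass_count N w)%:R :> R.
  by rewrite subr_ge0 ler_nat !pass_countS -addnA leq_addr.
have [sN|sN] := boolP (stopped N w).
  by rewrite sided_public // subrr mulr_ge0 // ltW.
have [pD|pD] := leP 0 (public M N w * sided w).
  have -> : `|public M N w| = public M N w * sided w.
    by rewrite -(ger0_norm pD) normrM normr_sided mulr1.
  by rewrite subrr mulr_ge0 // ltW.
have absE : `|public M N w| = - (public M N w * sided w).
  by rewrite -(ltr0_norm pD) normrM normr_sided mulr1.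
(* A step of [L_q] from the wrong side of 0 stays short of [L_q] on the right side, so the next user
   is not stopped either. *)
have sN1 : ~~ stopped N.+1 w.
  apply/negP => sN1; have := sided_public sN1; have := public_step sN.
  move: sN1 sN; rewrite /stopped -ltNge absE => lo hi pS E.
  move: lo; rewrite -{}E {}pS; move: pD hi.
  have /eqP := normr_sided w.
  by rewrite eqr_norml ler01 andbT => /orP[] /eqP ->; case: ifP => _; lra.
rewrite !pass_countS sN sN1 !addn1 -!natr1.
move: sN; rewrite /stopped -ltNge absE; lra.
Qed.

(** The two signs are treated differently. From above, the subtracted count absorbs the prefix
    evidence and only the correct log-odds remain. From below, the terms add up, and the
    disagreement bound is needed to avoid counting the delay repeatedly. *)
Lemma normr_remainder_le_delay N : prior_logodds M = 0 ->
  `|remainder N| <= logit (alpha M) + mean_delay * Lq.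
Proof.
move=> l0; have L0 := Lq_gt0.
have ic := integrable_norm_correct N.
have ip := integrable_norm_public N.
have corr_ge w : - `|correct_logodds M N w| <= correct_logodds M N w * sided w
    <= `|correct_logodds M N w|.
  by rewrite -ler_norml normrM normr_sided mulr1.
have ds_prefix : determined M N (fun w => - prefix_llr N w).
  by move=> w w' /determined_prefix_llr ->.
have ds_count : determined M N (fun w => (pass_count N w)%:R * Lq).
  by move=> w w' /determined_pass_count_self ->.
have is_prefix := integrable_determined_sided ds_prefix ds_count.
have lower : - remainder N <= logit (alpha M) + mean_delay * Lq.
  (* The horizon [N.+2] comes from the disagreement bound; it is harmless because the mean delay
     dominates [pass_count] at every horizon. *)
  apply: le_trans (mean_affine_pass_count_le _ N.+2).
  have -> : - remainder N = -1 * remainder N by rewrite mulN1r.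
  rewrite -RintegralZl //; last exact: integrable_remainder.
  apply: (@le_trans _ _ (\int[law M]_w (`|correct_logodds M N w| +
      (- prefix_llr N w * sided w + (pass_count N w)%:R * Lq)))).
    apply: le_Rintegral => //.
    - have /= := integrableZl measurableT (-1) (integrable_remainder N).
      by apply: eq_integrable => // w _; rewrite /= EFinM.
    - exact: integrable_law_add.
    by move=> w _; rewrite l0; have := corr_ge w; lra.
  rewrite [leLHS]RintegralD //.
  (* Jensen is applied before the pointwise estimate, since [public] can be compared with the prefix
     path by path. *)
  apply: le_trans (lerD (mean_correct_le N) (lexx _)) _.
  rewrite -RintegralD //; apply: le_Rintegral => //.
  - exact: integrable_law_add.
  - exact: integrable_affine_pass_count.
  move=> w _; have := public_disagreement N w.
  have := ler_norm (llr (AI M w) (alpha M) * sided w).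
  rewrite normrM normr_sided mulr1 normr_llr //.
  rewrite [X in _ - X * _]public_sum l0 -/(prefix_llr N w); lra.
rewrite ler_norml; apply/andP; split; first by lra.
rewrite -[logit _]add0r -(normr0 R) -l0.
apply: le_trans (mean_correct_le_delay N).
apply: le_Rintegral => //; first exact: integrable_remainder.
move=> w _; rewrite l0; have := corr_ge w.
have := ler_norm (prefix_llr N w * sided w).
rewrite normrM normr_sided mulr1; have := normr_prefix_llr_le N w.
lra.
Qed.

Lemma stopped0E w : prior_logodds M = 0 -> stopped 0 w = (Lq <= logit (alpha M)).
Proof. by move=> l0; rewrite /stopped /= l0 add0r normr_llr. Qed.

(** The first judgment reveals the AI signal and the others repeat it, so the observed event is a
    cylinder of length 0. *)
Lemma correct_logodds_herding N w : (0 < N)%N ->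
  (forall i w', judgment M i w' = AI M w') ->
  correct_logodds M N w = prior_logodds M + llr (AI M w) (alpha M).
Proof.
move=> N0 JE; rewrite correct_logoddsE.
have -> : same_judgments M N w = cylinder M (AI M w) (fun i => signal M i w) 0.
  apply/seteqP; split => [w' /(_ 0%N N0)|w' [ww' _] i _]; last by rewrite !JE.
  by rewrite !JE; split.
by rewrite !prob_cylinder ln_likelihood_ratio big_ord0 addr0.
Qed.

End Dynamics.

(** * The uniform bounds and the two cases with zero prior log-odds *)

Theorem theorem8 (R : realType) (d : measure_display) (Omega : measurableType d)
    (M : cascade_model R Omega)
    (q_itv : 1 / 2 < q M < 1) (alpha_itv : 1 / 2 < alpha M < 1) :
  [/\ (expected_delay M < +oo)%E,
      (forall N : nat, (0 < N)%N ->
        ('E_(law M)[(fun w => `|correct_logodds M N w|)%R] <=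
         (`|prior_logodds M| + logit (alpha M))%:E
         + expected_delay M * (logit (q M))%:E)%E),
      (exists (C : R) (r : nat -> R),
        (forall N : nat, (0 < N)%N -> `|r N| <= C) /\
        (forall N : nat, (0 < N)%N ->
          expected_excess M N = (N%:R * logit (q M) + r N)%:E)),
      (prior_logodds M = 0 -> q M <= alpha M ->
        [/\ (forall w : Omega, tau M w = 1%E),
            (forall (i : nat) (w : Omega), judgment M i w = AI M w),
            (forall (N : nat) (w : Omega), prefix_signals M N w = [::]),
            (forall (N : nat) (w : Omega), (0 < N)%N ->
              correct_logodds M N w = llr (AI M w) (alpha M)) &
            (forall N : nat, (0 < N)%N ->
              expected_excess M N =
              (N%:R * logit (q M) - logit (alpha M))%:E)]) &
      (prior_logodds M = 0 -> alpha M < q M ->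
        [/\ (forall w : Omega, (2%:E <= tau M w)%E),
            (forall (N : nat) (w : Omega), (0 < N)%N ->
              correct_logodds M N w = marginal_evidence M N w),
            (forall N : nat, (0 < N)%N ->
              expected_excess M N =
              ((N%:R * logit (q M))%:E + evidence_term M N)%E) &
            (forall N : nat, (0 < N)%N ->
              (`|evidence_term M N| <=
               (logit (alpha M))%:E
               + expected_delay M * (logit (q M))%:E)%E)])].
Proof.
have delay_fin := expected_delay_fin_num q_itv alpha_itv.
have delayE : expected_delay M = (mean_delay M)%:E by rewrite fineK.
have q01 : 0 < q M < 1 by move: q_itv; lra.
have alpha01 : 0 < alpha M < 1 by move: alpha_itv; lra.
have expE N : expected_excess M N = (N%:R * logit (q M) + remainder M N)%:E.
  exact: expected_excessE.
split.
- by rewrite delayE ltry.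
- move=> N N0; rewrite delayE -EFinM -EFinD.
  have := mean_correct_le_delay q_itv alpha_itv N; rewrite -lee_fin.
  rewrite unlock /Rintegral fineK //.
  exact: (integrable_fin_num measurableT (integrable_norm_correct q_itv alpha_itv N)).
- eexists; exists (remainder M); split => [N _|N _]; last exact: expE.
  exact: normr_remainder_le.
- move=> l0 qa.
  (* From [q <= alpha] the AI signal alone reaches the threshold, so the first user already
     herds. *)
  have s0 w : stopped M 0 w by rewrite stopped0E // ler_logit.
  have pE i w : public M i w = llr (AI M w) (alpha M).
    by rewrite (public_stopped q_itv alpha_itv (s0 w)) //= l0 add0r.
  have pc0 N w : pass_count M N w = 0%N.
    apply/eqP; rewrite -leqn0; exact: (pass_count_le_stopped q_itv alpha_itv).
  have La := logit_gt0 alpha_itv.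
  have JE i w : judgment M i w = AI M w.
    rewrite judgmentE // (stopped_mono q_itv alpha_itv (leq0n i)) //.
    by rewrite pE llr_sign; case: (AI M w); [rewrite ltW|apply/negbTE; rewrite -ltNge; lra].
  have cE N w : (0 < N)%N -> correct_logodds M N w = llr (AI M w) (alpha M).
    by move=> N0; rewrite correct_logodds_herding // l0 add0r.
  split=> //.
  + move=> w; apply/eqP; rewrite eq_le; apply/andP; split.
      by apply: ereal_inf_lbound; exists 0%N => //; exact: s0.
    have := pass_count_le_tau q_itv alpha_itv 0 w.
    by rewrite pc0 leeBrDr // add0e.
  + by move=> N w; apply: size0nil; rewrite size_prefix_signals.
  + move=> N N0; rewrite expE; congr (_ + _)%:E.
    rewrite -[RHS](Rintegral_law_cst M); apply: eq_Rintegral => w _.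
    (* With an empty prefix the integrand is the constant [- L_alpha], because the direction is the
       sign of the AI evidence. *)
    rewrite cE // l0 /prefix_llr pc0 big_ord0 mul0r subr0 !add0r mulNr.
    by rewrite -{1}(pE 0%N w) sided_public // pE normr_llr.
- move=> l0 aq.
  have s0 w : ~~ stopped M 0 w by rewrite stopped0E // -ltNge ltr_logit.
  split.
  (* The first user is not stopped, so the count at horizon 1 is 1 and [tau - 1] is at least 1. *)
  + move=> w; have := pass_count_le_tau q_itv alpha_itv 1 w.
    by rewrite /pass_count big_ord1 s0 leeBrDr // -EFinD.
  + by move=> N w _; apply: correct_logodds_marginal.
  + by move=> N _; rewrite evidence_termE // -EFinD.
  + move=> N _; rewrite evidence_termE // delayE -EFinM -EFinD lee_fin.
    exact: normr_remainder_le_delay.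
Qed.
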